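(* Let $(f_n)_{n\geq 1}$ be a sequence of entire functions which allows an admissible sequence of growth exponents $\lambda_1<\lambda_2<\cdots<\lambda_n\to\infty$, and let $$\mu(z)=\limsup_{n\to\infty}|f_n(z)|^{1/\lambda_n}\qquad(z\in\mathbb{C})$$ be the corresponding growth function. If $(f_n)$ converges compactly to a non-constant holomorphic function $f$ on some open set $D\subset\mathbb{C}$, then every point of the set $$\partial D\cap \overline{\{z\in\mathbb{C}:\mu(z)>1\}}$$ is a cluster point of zeros of the $f_n$.
   Context: Admissible growth exponents: a strictly increasing real sequence $\lambda_1<\lambda_2<\cdots<\lambda_n\to\infty$ is an admissible sequence of growth exponents for the sequence $(f_n)$ of entire functions if for every compact $K\subset\mathbb{C}$ there is a constant $c(K)<\infty$ with $$\limsup_{n\to\infty}\max_{z\in K}|f_n(z)|^{1/\lambda_n}\leq c(K).$$ (Only large $n$, for which $\lambda_n>0$, matter.) In this case the growth function $\mu:\mathbb{C}\to[0,\infty)$ is well defined. ''Converges compactly on $D$'' means converges uniformly on every compact subset of $D$. The overline denotes closure in $\mathbb{C}$ and $\partial D$ is the boundary of $D$ in $\mathbb{C}$. A point $z_0$ is a cluster point of zeros of the $f_n$ if for every open neighborhood $U$ of $z_0$ and every $n_0$ there is some $n\geq n_0$ such that $f_n$ has a zero in $U$.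
   Formalization: ''Non-constant'' is taken to mean non-constant on every connected component of the open set D (the same as non-constant when D is connected); if f may vanish identically on one component of a disconnected D, the claim is false. *)

(* Defs.v *)
From HB Require Import structures.
From mathcomp Require Export all_boot all_order all_algebra.
From mathcomp Require Export complex.
From mathcomp Require Export all_classical all_reals all_analysis.
Export Order.TTheory GRing.Theory Num.Theory.
Export numFieldNormedType.Exports.
Set Implicit Arguments.
Unset Strict Implicit.
Unset Printing Implicit Defensive.
#[global] Open Scope classical_set_scope.
#[global] Open Scope ring_scope.

(* The topology, the vector space and the normed module structures of [R[i]]
   are those of the field [R[i]] over itself; in particular the topology is the
   one of the complex modulus. *)
HB.instance Definition _ (R : realType) := GRing.ComAlgebra.copy R[i] R[i]^o.
HB.instance Definition _ (R : realType) := Vector.copy R[i] R[i]^o.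
HB.instance Definition _ (R : realType) := NormedModule.copy R[i] R[i]^o.

Section Defs.
Variable R : realType.
Local Notation C := (R[i]).

(* [derivable f z 1] at [C] as a module over itself is differentiability in the
   complex sense: the increment ranges over [C], not over the reals. *)
Definition holomorphic (D : set C) (f : C -> C) : Prop :=
  forall z, D z -> derivable f z 1.

Definition entire (f : C -> C) : Prop := holomorphic setT f.

(* At a zero of [f n] this is [0] whenever [lambda n > 0]; the finitely many
   other indices do not affect the limsups below. *)
Definition growth_term (f : nat -> C -> C) (lambda : nat -> R) (n : nat)
  (z : C) : \bar R := (Normc.normc (f n z) `^ (lambda n)^-1)%:E.

(* Valued in [\bar R]; it is finite and nonnegative for admissible [lambda]. *)
Definition growth (f : nat -> C -> C) (lambda : nat -> R) (z : C) : \bar R :=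
  limn_esup (fun n => growth_term f lambda n z).

(* The supremum below is a maximum when [K] is nonempty and [0 < lambda n]. *)
Definition admissible (f : nat -> C -> C) (lambda : nat -> R) : Prop :=
  [/\ {homo lambda : m n / (m < n)%N >-> m < n},
      lambda n @[n --> \oo] --> +oo%R &
      forall K : set C, compact K -> exists c : R,
        (limn_esup (fun n => ereal_sup (growth_term f lambda n @` K)) <= c%:E)%E].

Definition converges_compactly (D : set C) (f : nat -> C -> C) (g : C -> C) :
  Prop :=
  forall K : set C, compact K -> K `<=` D -> {uniform K, f @ \oo --> g}.

(* Not constant on any connected component of [D]. For connected nonempty [D]
   this is plain non-constancy on [D]. *)
Definition nonconstant (D : set C) (g : C -> C) : Prop :=
  forall z, D z ->
    ~ exists c : C, forall w, connected_component D z w -> g w = c.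

Definition boundary (D : set C) : set C := closure D `\` interior D.

Definition zero_cluster (f : nat -> C -> C) (z0 : C) : Prop :=
  forall U : set C, open U -> U z0 -> forall n0 : nat,
    exists2 n : nat, (n0 <= n)%N & exists2 z, U z & f n z = 0.

End Defs.

(* Main.v *)
(* Near a boundary point [z0] that is not a cluster point of zeros, the [f n] are
   zero-free on a fixed disc for large [n], so [ln |f n| / lambda n] is there the real
   part of a holomorphic function up to a constant, bounded above by admissibility.
   By the identity theorem the disc contains, as close to [z0] as we like, a point
   [p] of [D] with [g p != 0]; near [p] the [f n] converge to a nonvanishing limit, so
   these functions tend to [0] there.  Borel-Caratheodory and Taylor's formula with
   remainder propagate this to a disc around [p] whose radius does not depend on [p],
   hence to a neighbourhood of [z0], where therefore [mu <= 1].

   Complex integration is by limits of dyadic midpoint sums along segments: bisecting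
   a segment is then exact, which is what Goursat's subdivision of triangles needs, and
   Cauchy's formula is obtained on squares. *)
Require Import Defs.
From mathcomp Require Import ring lra.
Set Implicit Arguments.
Unset Strict Implicit.
Unset Printing Implicit Defensive.

(** * The complex modulus *)

Section Modulus.
Variable R : realType.
Local Notation C := R[i].
Local Notation N := (@Normc.normc R).
Implicit Types (x y z w : C) (r e d : R).

(** The obstacle: the disc around [p] on which the [f n] are known to converge may shrink as [p]
    approaches the boundary of [D], while the conclusion needs a radius that does not. The
    two-radius estimate [propagation] resolves this. Finitely many Taylor coefficients are bounded
    on the small disc, so that the ratio of the radii enters only through a fixed finite sum,
    multiplied by a quantity tending to [0]; the remainder is bounded on the large disc and is
    geometrically small. Hence the small radius affects only how large [n] must be. With bound [0]
    on the small disc the same estimate yields the identity theorem. The radius loses absolute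
    factors: 1/2 to pass from an open to a closed disc, 1/16 in Borel-Caratheodory and 1/4 in
    Taylor's formula, whence [r / 128]. The constants are crude on purpose; what matters is that
    these factors depend neither on [p] nor on [n]. The logarithm is built as a primitive of the
    logarithmic derivative, which is why derivatives must first be shown to be holomorphic. *)

Lemma norm_normc x : `|x| = (N x)%:C%C.
Proof. by []. Qed.

Lemma normc_ge0 x : 0 <= N x.
Proof. by rewrite -ler0c -norm_normc. Qed.

Lemma normcD x y : N (x + y) <= N x + N y.
Proof. exact: (@le_normcD R x y). Qed.

Lemma normc_opp x : N (- x) = N x.
Proof. exact: (@normcN R x). Qed.

Lemma normcB x y : N (x - y) <= N x + N y.
Proof. by rewrite -(normc_opp y); exact: normcD. Qed.

Lemma normc_distC x y : N (x - y) = N (y - x).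
Proof. by rewrite -opprB normc_opp. Qed.

Lemma normcBr x y : N x - N y <= N (x - y).
Proof. by rewrite lerBlDr; have := normcD (x - y) y; rewrite subrK. Qed.

Lemma normc_split z x y : N (x - y) <= N (x - z) + N (z - y).
Proof. by have := normcD (x - z) (z - y); rewrite addrA subrK. Qed.

Lemma normc_eq0 x : (N x == 0) = (x == 0).
Proof.
apply/eqP/eqP => [/Normc.eq0_normc//|->]; exact: Normc.normc0.
Qed.

Lemma normc_gt0 x : (0 < N x) = (x != 0).
Proof. by rewrite lt_def normc_ge0 andbT normc_eq0. Qed.

Lemma normcX x n : N (x ^+ n) = N x ^+ n.
Proof.
elim: n => [|n IH]; first by rewrite !expr0; exact: Normc.normc1.
by rewrite !exprS Normc.normcM IH.
Qed.

Lemma normc_div x y : N (x / y) = N x / N y.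
Proof. by rewrite Normc.normcM Normc.normcV. Qed.

Lemma normc_real r : N (r%:C%C) = `|r|.
Proof. by rewrite /Normc.normc /= expr0n addr0 sqrtr_sqr. Qed.

Lemma normc_nat n : N (n%:R) = n%:R.
Proof.
by rewrite -(rmorph_nat (real_complex R)) normc_real ger0_norm.
Qed.

Lemma normc_Re x : `|complex.Re x| <= N x.
Proof. by have := normc_ge_Re x; rewrite norm_normc lecR. Qed.

Lemma Re_le x : complex.Re x <= N x.
Proof. exact: le_trans (ler_norm _) (normc_Re x). Qed.

Lemma normc_Im x : `|complex.Im x| <= N x.
Proof.
case: x => a b /=; rewrite -sqrtr_sqr ler_sqrt ?lerDr ?sqr_ge0//.
by rewrite addr_ge0 ?sqr_ge0.
Qed.

Lemma normc_ReIm x : N x <= `|complex.Re x| + `|complex.Im x|.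
Proof.
case: x => a b /=; rewrite -[leRHS]ger0_norm ?addr_ge0// -sqrtr_sqr.
rewrite ler_sqrt ?sqr_ge0// sqrrD !real_normK ?num_real//.
by rewrite lerD2r lerDl mulrn_wge0 // mulr_ge0.
Qed.

Lemma ReD x y : complex.Re (x + y) = complex.Re x + complex.Re y.
Proof. by case: x; case: y. Qed.
Lemma ReB x y : complex.Re (x - y) = complex.Re x - complex.Re y.
Proof. by case: x; case: y. Qed.
Lemma ImD x y : complex.Im (x + y) = complex.Im x + complex.Im y.
Proof. by case: x; case: y. Qed.
Lemma ImB x y : complex.Im (x - y) = complex.Im x - complex.Im y.
Proof. by case: x; case: y. Qed.
Lemma Re_realM r x : complex.Re (r%:C%C * x) = r * complex.Re x.
Proof. by case: x => a b /=; rewrite mul0r subr0. Qed.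
Lemma gtc0_real (e : C) : 0 < e -> 0 < complex.Re e /\ e = (complex.Re e)%:C%C.
Proof.
by case: e => a b; rewrite ltcE /= => /andP[/eqP -> ?].
Qed.

Lemma cvg_normcP (T : Type) (F : set_system T) {FF : Filter F} (f : T -> C) (l : C) :
  f @ F --> l <-> forall e, 0 < e -> \forall t \near F, N (f t - l) <= e.
Proof.
split.
  move=> /cvgrPdist_le H e e0.
  have /H : 0 < e%:C%C :> C by rewrite ltcR.
  by apply: filterS => t; rewrite norm_normc lecR normc_distC.
move=> H; apply/cvgrPdist_le => e /gtc0_real[e0 ->].
by move: (H _ e0); apply: filterS => t; rewrite norm_normc lecR normc_distC.
Qed.

Lemma cvgn_normcP (u : nat -> C) (l : C) : u n @[n --> \oo] --> l <->
  forall e, 0 < e -> exists n0, forall n, (n0 <= n)%N -> N (u n - l) <= e.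
Proof.
have [H1 H2] := @cvg_normcP _ \oo eventually_filter u l.
split.
  by move=> /H1 H e /H[n0 _ Hn]; exists n0.
by move=> H; apply: H2 => e /H[n0 Hn]; exists n0.
Qed.

Lemma nbhs_normcP (z : C) (P : set C) :
  nbhs z P <-> exists2 d, 0 < d & forall w, N (w - z) < d -> P w.
Proof.
split.
  move=> /nbhs_ballP[e /= /gtc0_real[e0 E]] H.
  exists (complex.Re e) => // w wz; apply: H.
  by rewrite -ball_normE /= E norm_normc ltcR normc_distC.
move=> [d d0 H]; apply/nbhs_ballP; exists (d%:C%C); first by rewrite /= ltcR.
move=> w; rewrite -ball_normE /= norm_normc ltcR normc_distC; exact: H.
Qed.

Lemma continuous_normcP (f : C -> C) (z : C) : {for z, continuous f} <->
  forall e, 0 < e -> exists2 d, 0 < d & forall w, N (w - z) < d -> N (f w - f z) <= e.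
Proof.
rewrite /prop_for /continuous_at.
have [H1 H2] := @cvg_normcP _ (nbhs z) _ f (f z).
split.
  by move=> /H1 H e e0; apply/nbhs_normcP; exact: H.
by move=> H; apply: H2 => e e0; apply/nbhs_normcP; exact: H.
Qed.

(** The difference quotient is multiplied through by the increment, so that [w = z] is allowed and
    no punctured neighbourhood appears in later estimates. *)
Lemma is_deriveCP (f : C -> C) (z l : C) : is_derive z 1 f l <->
  forall e, 0 < e -> exists2 d, 0 < d &
    forall w, N (w - z) < d -> N (f w - f z - l * (w - z)) <= e * N (w - z).
Proof.
have E (h : C) : h != 0 -> h^-1 *: ((f \o shift z) (h *: 1) - f z) - l =
     h^-1 * (f (z + h) - f z - l * h).
  move=> h0.
  have -> : (f \o shift z) (h *: 1) = f (z + h).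
    by rewrite /= /GRing.scale /= mulr1 addrC.
  by rewrite /GRing.scale /=; field.
have key : (h^-1 *: ((f \o shift z) (h *: 1) - f z) @[h --> 0^'] --> l) <->
  forall e, 0 < e -> exists2 d, 0 < d &
    forall w, N (w - z) < d -> N (f w - f z - l * (w - z)) <= e * N (w - z).
  have [H1 H2] := @cvg_normcP _ (0^' : set_system C) _
    (fun h => h^-1 *: ((f \o shift z) (h *: 1) - f z)) l.
  split.
    move=> /H1 H e e0; have := H e e0.
    rewrite near_withinE => /nbhs_normcP[d d0 Hd]; exists d => // w wz.
    have [->|wz0] := eqVneq w z.
      by rewrite !subrr mulr0 subrr Normc.normc0 mulr0.
    have h0 : w - z != 0 by rewrite subr_eq0.
    have := Hd (w - z); rewrite subr0 => /(_ wz h0).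
    rewrite E // Normc.normcM Normc.normcV (addrC z) subrK.
    by rewrite ler_pdivrMl ?normc_gt0// [leRHS]mulrC.
  move=> H; apply: H2 => e e0; rewrite near_withinE; apply/nbhs_normcP.
  have [d d0 Hd] := H e e0; exists d => // h; rewrite subr0 => hd h0.
  have := Hd (z + h); rewrite (addrC z) addrK => /(_ hd).
  rewrite E // Normc.normcM Normc.normcV (addrC z).
  by rewrite ler_pdivrMl ?normc_gt0// [leRHS]mulrC.
split.
  by case=> H E0; apply/key; rewrite -E0; exact: H.
move=> /key H; split; first by apply/cvg_ex; exists l.
exact: cvg_lim H.
Qed.

Lemma is_derive_cont (f : C -> C) z l : is_derive z 1 f l -> {for z, continuous f}.
Proof.
move=> [H _]; apply: differentiable_continuous; exact/derivable1_diffP.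
Qed.

(** Real and imaginary parts are 1-Lipschitz, so completeness is inherited from [R]. *)
Lemma cauchy_cvgn (u : nat -> C) :
  (forall e, 0 < e -> exists n0, forall n, (n0 <= n)%N -> N (u n - u n0) <= e) ->
  cvgn u.
Proof.
move=> H.
have aux (p : C -> R) : (forall x y, `|p x - p y| <= N (x - y)) -> cvgn (p \o u).
  move=> pl; apply/cauchy_cvgP/cauchy_exP => e e0.
  have e2 : 0 < e / 2 by rewrite divr_gt0.
  have [n0 Hn] := H _ e2.
  exists (p (u n0)); rewrite -ball_normE.
  suff : \forall n \near \oo, `|p (u n0) - p (u n)| < e by [].
  near=> n; apply: le_lt_trans (pl _ _) _.
  rewrite normc_distC; apply: le_lt_trans (Hn n _) _; first by near: n; exists n0.
  by rewrite ltr_pdivrMr// ltr_pMr// ltr1n.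
have /cvg_ex[a Ha] := aux (@complex.Re R) (fun x y => ltac:(rewrite -ReB; exact: normc_Re)).
have /cvg_ex[b Hb] := aux (@complex.Im R) (fun x y => ltac:(rewrite -ImB; exact: normc_Im)).
apply/cvg_ex; exists (a +i* b)%C; apply/cvg_normcP => e e0.
have e2 : 0 < e / 2 by rewrite divr_gt0.
near=> n.
apply: le_trans (normc_ReIm _) _; rewrite ReB ImB /= distrC (distrC _ b).
rewrite (splitr e) lerD//; near: n.
  by move/cvgrPdist_le: Ha; apply.
by move/cvgrPdist_le: Hb; apply.
Unshelve. all: end_near. Qed.

End Modulus.

(** * Dyadic midpoint sums *)

Section Integral.
Variable R : realType.
Local Notation C := R[i].
Local Notation N := (@Normc.normc R).
Implicit Types (a b c x y z w : C) (r s t e d : R) (f g : C -> C) (k n : nat).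

Definition seg a b : set C :=
  [set x | exists2 t, 0 <= t <= 1 & x = a + t%:C%C * (b - a)].

Definition convex_subset (P : set C) := forall a b, P a -> P b -> seg a b `<=` P.

Lemma seg_l a b : seg a b a.
Proof. by exists 0; rewrite ?lexx ?ler01// mul0r addr0. Qed.

Lemma seg_r a b : seg a b b.
Proof. by exists 1; rewrite ?lexx ?ler01// mul1r addrC subrK. Qed.

Lemma seg_convex a b : convex_subset (seg a b).
Proof.
move=> _ _ [t /andP[t0 t1] ->] [s /andP[s0 s1] ->] _ [u /andP[u0 u1] ->].
exists (t + u * (s - t)); last by rewrite !(rmorphD, rmorphB, rmorphM) /=; ring.
by apply/andP; split; nra.
Qed.

Lemma half2 : (2^-1)%:C%C = 2^-1 :> C.
Proof. by rewrite fmorphV rmorph_nat. Qed.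

Lemma seg_mid a b : seg a b ((a + b) / 2).
Proof.
exists 2^-1; first by lra.
by rewrite half2; field.
Qed.

Lemma seg_subl a b : seg a ((a + b) / 2) `<=` seg a b.
Proof. apply: seg_convex; [exact: seg_l|exact: seg_mid]. Qed.

Lemma seg_subr a b : seg ((a + b) / 2) b `<=` seg a b.
Proof. apply: seg_convex; [exact: seg_mid|exact: seg_r]. Qed.

Lemma seg_dist a b x : seg a b x -> N (x - a) <= N (b - a).
Proof.
move=> [t /andP[t0 t1] ->]; rewrite addrC addKr Normc.normcM normc_real ger0_norm//.
by rewrite ler_piMl// normc_ge0.
Qed.

Lemma normc2 : N 2 = 2.
Proof. exact: normc_nat. Qed.

Lemma mid_distl a b : N ((a + b) / 2 - a) = N (b - a) / 2.
Proof. by rewrite -normc2 -normc_div; congr N; field. Qed.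

Lemma mid_distr a b : N (b - (a + b) / 2) = N (b - a) / 2.
Proof. by rewrite -normc2 -normc_div; congr N; field. Qed.

(* The midpoint rule is antisymmetric in the endpoints and exact on affine
   functions at every level, so neither fact requires a limit. *)
Fixpoint dsum f k a b : C :=
  if k is k'.+1 then dsum f k' a ((a + b) / 2) + dsum f k' ((a + b) / 2) b
  else (b - a) * f ((a + b) / 2).

Lemma dsum_lin f g c k a b :
  dsum (fun x => c * f x + g x) k a b = c * dsum f k a b + dsum g k a b.
Proof.
elim: k a b => [|k IH] a b /=; first by ring.
by rewrite !IH; ring.
Qed.

Lemma dsum_affine (p q : C) k a b :
  dsum (fun x => p + q * x) k a b = p * (b - a) + q * (b ^+ 2 - a ^+ 2) / 2.
Proof.
elim: k a b => [|k IH] a b /=; first by field.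
by rewrite !IH; field.
Qed.

Lemma dsumN f k a b : dsum f k b a = - dsum f k a b.
Proof.
elim: k a b => [|k IH] a b /=; first by rewrite (addrC b a); ring.
by rewrite (addrC b a) (IH a) (IH _ b); ring.
Qed.

Lemma dsum_ext f g k a b : (forall x, seg a b x -> f x = g x) ->
  dsum f k a b = dsum g k a b.
Proof.
elim: k a b => [|k IH] a b H /=; first by rewrite H//; exact: seg_mid.
by congr (_ + _); apply: IH => x Hx; apply: H; [exact: seg_subl|exact: seg_subr].
Qed.

Lemma dsum_le f (M : R) k a b : (forall x, seg a b x -> N (f x) <= M) ->
  N (dsum f k a b) <= M * N (b - a).
Proof.
elim: k a b => [|k IH] a b H /=.
  by rewrite Normc.normcM mulrC ler_wpM2r ?normc_ge0//; apply: H; exact: seg_mid.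
apply: le_trans (normcD _ _) _.
have -> : M * N (b - a) = M * N ((a + b) / 2 - a) + M * N (b - (a + b) / 2).
  by rewrite mid_distl mid_distr; field.
by apply: lerD; apply: IH => x Hx; apply: H; [exact: seg_subl|exact: seg_subr].
Qed.

(** Oscillation at most [e] on each of the [2 ^ k] dyadic pieces. It is required on whole pieces,
    not just at midpoints, so that it passes to every finer level. *)
Fixpoint fine f e k a b : Prop :=
  if k is k'.+1 then fine f e k' a ((a + b) / 2) /\ fine f e k' ((a + b) / 2) b
  else forall x y, seg a b x -> seg a b y -> N (f x - f y) <= e.

Lemma fine_leq f e k n a b : (k <= n)%N -> fine f e k a b -> fine f e n a b.
Proof.
elim: n k a b => [|n IH] [|k] a b //=.
  move=> _ H; split; apply: (IH 0%N) => // x y Hx Hy; apply: H.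
  - exact: seg_subl. - exact: seg_subl. - exact: seg_subr. - exact: seg_subr.
by rewrite ltnS => kn [? ?]; split; apply: (IH k).
Qed.

(** On a single piece the coarse sum equals the fine sum of the constant [f m], because constants
    are summed exactly; only the oscillation of [f] around its midpoint value remains. *)
Lemma dsum_fine f e k n a b : fine f e k a b ->
  N (dsum f (k + n) a b - dsum f k a b) <= e * N (b - a).
Proof.
elim: k a b => [|k IH] a b /=.
  move=> H; set m := (a + b) / 2.
  have -> : dsum f (0 + n) a b - (b - a) * f m =
      dsum (fun x => 1 * f x + (- f m + 0 * x)) n a b.
    by rewrite add0n dsum_lin dsum_affine; ring.
  apply: dsum_le => x Hx; rewrite mul1r mul0r addr0; apply: H => //.
  exact: seg_mid.
move=> [Hl Hr]; 
have -> : e * N (b - a) = e * N ((a + b) / 2 - a) + e * N (b - (a + b) / 2).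
  by rewrite mid_distl mid_distr; field.
rewrite opprD addrACA; apply: le_trans (normcD _ _) _.
by apply: lerD; apply: IH.
Qed.

Lemma half_cvg0 (D e : R) : 0 < e -> exists n, forall k, (n <= k)%N -> D * 2^-1 ^+ k <= e.
Proof.
move=> e0.
have H : D * 2^-1 ^+ k @[k --> \oo] --> D * 0.
  by apply: cvgM; [exact: cvg_cst|apply: cvg_expr; rewrite ger0_norm; lra].
rewrite mulr0 in H.
move/cvgr0_norm_le : H => /(_ _ e0)[n _ Hn]; exists n => k nk.
exact: le_trans (ler_norm _) (Hn k nk).
Qed.

(** Gives the limit point of nested bisections; the explicit tail bound serves to place a whole
    small piece near that point. *)
Lemma geom_limit (u : nat -> C) (D : R) :
  (forall k, N (u k.+1 - u k) <= D * 2^-1 ^+ k) ->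
  exists2 z : C, u n @[n --> \oo] --> z & forall k, N (z - u k) <= 2 * D * 2^-1 ^+ k.
Proof.
move=> H.
have D0 : 0 <= D by have := H 0%N; rewrite expr0 mulr1; apply: le_trans; exact: normc_ge0.
have p2 k : 0 <= (2^-1 : R) ^+ k by rewrite exprn_ge0.
(* The factor [1 - 2^-1 ^+ n] is the partial geometric sum; without it the induction on [n] would
   not close. *)
have Hk k n : N (u (k + n)%N - u k) <= 2 * D * 2^-1 ^+ k * (1 - 2^-1 ^+ n).
  elim: n => [|n IH]; first by rewrite addn0 subrr Normc.normc0 expr0 subrr mulr0.
  apply: le_trans (normc_split (u (k + n)%N) _ _) _.
  rewrite addnS; apply: le_trans (lerD (H (k + n)%N) IH) _; rewrite exprD exprS.
  by rewrite le_eqVlt; apply/orP; left; apply/eqP; field.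
have Hk' k n : (k <= n)%N -> N (u n - u k) <= 2 * D * 2^-1 ^+ k.
  move=> /subnKC <-; apply: le_trans (Hk k _) _.
  by apply: ler_piMr; rewrite ?gerBl// !mulr_ge0.
have cu : cvgn u.
  apply: cauchy_cvgn => e e0; have [n0 Hn0] := half_cvg0 (2 * D) e0.
  exists n0 => n /Hk' Hn; apply: le_trans Hn _; exact: Hn0.
exists (limn u) => // k.
apply/ler_addgt0Pl => e e0.
have [m Hm] := (cvgn_normcP u (limn u)).1 cu e e0.
have := Hm (maxn m k) (leq_maxl _ _); rewrite normc_distC => Hm'.
apply: le_trans (normc_split (u (maxn m k)) _ _) _.
by apply: lerD => //; apply: Hk'; exact: leq_maxr.
Qed.

Lemma seg_closed a b : closed (seg a b).
Proof.
apply: compact_closed; first exact: norm_hausdorff.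
have -> : seg a b = (fun t => a + t%:C%C * (b - a)) @` `[0, 1].
  apply/seteqP; split => x.
    by move=> [t t01 ->]; exists t => //=; rewrite in_itv.
  by move=> [t /= + <-]; rewrite in_itv => ?; exists t.
apply: continuous_compact; last exact: segment_compact.
apply: continuous_subspaceT => t; apply/cvg_normcP => e e0.
have D0 : 0 < N (b - a) + 1 by rewrite ltr_wpDl ?normc_ge0.
near=> s.
have -> : a + s%:C%C * (b - a) - (a + t%:C%C * (b - a)) = (s - t)%:C%C * (b - a).
  by rewrite rmorphB; ring.
rewrite Normc.normcM normc_real.
apply: (@le_trans _ _ (e / (N (b - a) + 1) * (N (b - a) + 1))); last first.
  by rewrite divfK// gt_eqF.
apply: ler_pM; rewrite ?normc_ge0//; last by rewrite lerDl.
rewrite distrC; near: s.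
by apply: (@cvgr_dist_le _ _ _ _ _ (fun s : R => s)) => //; rewrite divr_gt0.
Unshelve. all: end_near. Qed.

Lemma closed_limit (P : set C) (u : nat -> C) z : closed P -> (forall n, P (u n)) ->
  u n @[n --> \oo] --> z -> P z.
Proof.
move=> Pc Pu uz; apply: (closed_cvg P Pc _ _ uz).
by near=> n; exact: Pu.
Unshelve. all: end_near. Qed.

(** Uniform continuity by bisection: if no level is fine on a segment, the same holds on one of its
    halves, and the nested bad halves shrink to a point at which continuity is contradicted. *)
Lemma fine_exists f e a b : 0 < e -> (forall x, seg a b x -> {for x, continuous f}) ->
  exists k, fine f e k a b.
Proof.
move=> e0 cf; apply: contrapT => Hbad.
pose bad (p : C * C) := ~ exists k, fine f e k p.1 p.2.
pose mid (p : C * C) := (p.1 + p.2) / 2.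
pose nxt p := if `[< bad (p.1, mid p) >] then (p.1, mid p) else (mid p, p.2).
pose c k := iter k nxt (a, b).
have badc k : bad (c k).
  elim: k => [//|k IH]; rewrite /c /= -/(c k) /nxt.
  case: asboolP => // /contrapT[k1 H1] [k2 /= H2]; apply: IH.
  exists (maxn k1 k2).+1 => /=; split.
    exact: fine_leq (leq_maxl _ _) H1.
  exact: fine_leq (leq_maxr _ _) H2.
have segS k : seg (c k.+1).1 (c k.+1).2 `<=` seg (c k).1 (c k).2.
  rewrite /c /= -/(c k) /nxt; case: ifP => _; [exact: seg_subl|exact: seg_subr].
have segk k : seg (c k).1 (c k).2 `<=` seg a b.
  by elim: k => [//|k IH] x /segS; exact: IH.
have len k : N ((c k).2 - (c k).1) = N (b - a) * 2^-1 ^+ k.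
  elim: k => [|k IH]; first by rewrite expr0 mulr1.
  rewrite exprSr mulrA -IH /c /= -/(c k) /nxt; case: ifP => _ /=.
    exact: mid_distl.
  exact: mid_distr.
have [|z cz Hz] := @geom_limit (fun k => (c k).1) (N (b - a)).
  move=> k; rewrite -len; apply: seg_dist; apply: segS; exact: seg_l.
have zab : seg a b z.
  by apply: (closed_limit (@seg_closed a b) _ cz) => k; apply: segk; exact: seg_l.
have [d d0 Hd] := (continuous_normcP f z).1 (cf z zab) (e / 2) ltac:(by rewrite divr_gt0).
(* A point of the [k]-th segment is within one length of its left end, which is within two lengths
   of [z]. *)
have [k Hk] := half_cvg0 (3 * N (b - a)) (divr_gt0 d0 (ltr0Sn R 1)).
apply: (badc k); exists 0%N => x y Hx Hy.
have close w : seg (c k).1 (c k).2 w -> N (f w - f z) <= e / 2.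
  move=> /seg_dist; rewrite len => Hw; apply: Hd.
  apply: le_lt_trans (normc_split (c k).1 _ _) _.
  have := Hk k (leqnn k); have := Hz k; rewrite normc_distC; lra.
apply: le_trans (normc_split (f z) _ _) _.
by rewrite (splitr e) lerD ?close// normc_distC close.
Qed.

End Integral.

(** * Integrals along segments and Goursat's lemma *)

Section Integral.
Variable R : realType.
Local Notation C := R[i].
Local Notation N := (@Normc.normc R).
Implicit Types (a b c x y z w : C) (r s t e d : R) (f g : C -> C) (k n : nat).

Definition seg_int f a b : C := limn (fun k => dsum f k a b).

Definition cont_on (P : set C) f := forall x, P x -> {for x, continuous f}.

Lemma cont_onS (P Q : set C) f : P `<=` Q -> cont_on Q f -> cont_on P f.
Proof. by move=> PQ cf x /PQ; exact: cf. Qed.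

Lemma seg_int_cvg f a b : cont_on (seg a b) f ->
  dsum f k a b @[k --> \oo] --> seg_int f a b.
Proof.
move=> cf; suff : cvgn (fun k => dsum f k a b) by [].
apply: cauchy_cvgn => e e0.
have D0 : 0 < N (b - a) + 1 by rewrite ltr_wpDl ?normc_ge0.
have [k Hk] := fine_exists (divr_gt0 e0 D0) cf.
exists k => n /subnKC <-; apply: le_trans (dsum_fine _ Hk) _.
by rewrite mulrAC ler_pdivrMr// ler_wpM2l ?lerDl// ltW.
Qed.

Lemma seg_int_uniq f a b z : dsum f k a b @[k --> \oo] --> z -> seg_int f a b = z.
Proof. by move=> H; apply: cvg_lim H; exact: norm_hausdorff. Qed.

Lemma seg_int_lin f g c a b : cont_on (seg a b) f -> cont_on (seg a b) g ->
  seg_int (fun x => c * f x + g x) a b = c * seg_int f a b + seg_int g a b.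
Proof.
move=> cf cg; apply: seg_int_uniq.
under eq_fun do rewrite dsum_lin.
by apply: cvgD; [apply: cvgM; [exact: cvg_cst|exact: seg_int_cvg]|exact: seg_int_cvg].
Qed.

Lemma seg_int_affine (p q : C) a b :
  seg_int (fun x => p + q * x) a b = p * (b - a) + q * (b ^+ 2 - a ^+ 2) / 2.
Proof.
apply: seg_int_uniq; under eq_fun do rewrite dsum_affine.
exact: cvg_cst.
Qed.

Lemma seg_intN f a b : cont_on (seg a b) f -> seg_int f b a = - seg_int f a b.
Proof.
move=> cf; apply: seg_int_uniq; under eq_fun do rewrite dsumN.
by apply: cvgN; exact: seg_int_cvg.
Qed.

Lemma seg_int_ext f g a b : (forall x, seg a b x -> f x = g x) -> seg_int f a b = seg_int g a b.
Proof.
move=> fg; congr (limn _); apply/funext => k; exact: dsum_ext.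
Qed.

Lemma seg_int_mid f a b : cont_on (seg a b) f ->
  seg_int f a b = seg_int f a ((a + b) / 2) + seg_int f ((a + b) / 2) b.
Proof.
move=> cf; apply: seg_int_uniq; rewrite -(cvg_shiftS _) /=.
apply: cvgD; apply: seg_int_cvg; apply: cont_onS cf;
  [exact: seg_subl|exact: seg_subr].
Qed.

Lemma seg_int_le f (M : R) a b : cont_on (seg a b) f ->
  (forall x, seg a b x -> N (f x) <= M) -> N (seg_int f a b) <= M * N (b - a).
Proof.
move=> cf H; apply/ler_addgt0Pl => e e0.
have [n Hn] := (cvgn_normcP _ _).1 (seg_int_cvg cf) e e0.
apply: le_trans (_ : _ <= N (seg_int f a b - dsum f n a b) + N (dsum f n a b)) _.
  by have := normcD (seg_int f a b - dsum f n a b) (dsum f n a b); rewrite subrK.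
by apply: lerD; [rewrite normc_distC; exact: Hn|exact: dsum_le].
Qed.

(** The form in which differentiability and continuity enter integrals: the affine part is
    integrated exactly, the error costs at most its bound times the length. *)
Lemma seg_int_affine_le f (p q : C) (M : R) a b : cont_on (seg a b) f ->
  (forall x, seg a b x -> N (f x - (p + q * x)) <= M) ->
  N (seg_int f a b - (p * (b - a) + q * (b ^+ 2 - a ^+ 2) / 2)) <= M * N (b - a).
Proof.
move=> cf H; rewrite -seg_int_affine.
have ca : cont_on (seg a b) (fun x => p + q * x).
  move=> x _; apply: continuousD; first exact: cst_continuous.
  by apply: continuousM; [exact: cst_continuous|exact: cvg_id].
have -> : seg_int f a b - seg_int (fun x => p + q * x) a b =
    seg_int (fun x => -1 * (p + q * x) + f x) a b.
  by rewrite seg_int_lin// mulN1r addrC.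
apply: seg_int_le => [x Hx|x Hx]; last by rewrite mulN1r addrC; exact: H.
apply: continuousD; last exact: cf.
by apply: continuousM; [exact: cst_continuous|exact: ca].
Qed.

(** * Goursat's lemma for triangles *)

Definition tri_int f a b c := seg_int f a b + seg_int f b c + seg_int f c a.

(** The outer sides are halved exactly, and each of the three inner sides is run through once in
    each direction. *)
Lemma tri_int_mid f (P : set C) a b c : convex_subset P -> cont_on P f -> P a -> P b -> P c ->
  tri_int f a b c = tri_int f a ((a + b) / 2) ((c + a) / 2) +
    tri_int f ((a + b) / 2) b ((b + c) / 2) + tri_int f ((c + a) / 2) ((b + c) / 2) c +
    tri_int f ((b + c) / 2) ((c + a) / 2) ((a + b) / 2).
Proof.
move=> Pc cf Pa Pb Pd.
have Pm x y : P x -> P y -> P ((x + y) / 2).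
  by move=> Px Py; apply: (Pc _ _ Px Py); exact: seg_mid.
have cs x y : P x -> P y -> cont_on (seg x y) f.
  by move=> Px Py; apply: cont_onS cf; exact: Pc.
have [Pab Pbd Pda] : [/\ P ((a + b) / 2), P ((b + c) / 2) & P ((c + a) / 2)].
  by split; exact: Pm.
rewrite /tri_int (seg_int_mid (cs _ _ Pa Pb)) (seg_int_mid (cs _ _ Pb Pd)).
rewrite (seg_int_mid (cs _ _ Pd Pa)).
rewrite (seg_intN (cs _ _ Pab Pda)) (seg_intN (cs _ _ Pbd Pab)) (seg_intN (cs _ _ Pda Pbd)).
by ring.
Qed.

(** Halving the sides divides the squared perimeter by 4, so if the bound fails for a triangle it
    fails for one of its four parts. The nested bad triangles shrink to a point of the closed set
    [P], where the linear approximation of [f] gives a contradiction. *)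
Lemma cauchy_triangle_le f (P : set C) a b c e : convex_subset P -> closed P ->
  (forall x, P x -> derivable f x 1) -> P a -> P b -> P c -> 0 < e ->
  N (tri_int f a b c) <= e * (N (b - a) + N (c - b) + N (a - c)) ^+ 2.
Proof.
move=> Pc Pcl df Pa Pb Pd e0.
have cf : cont_on P f.
  by move=> x /df H; apply: is_derive_cont; exact: derivableP H.
pose per (T : C * C * C) := N (T.1.2 - T.1.1) + N (T.2 - T.1.2) + N (T.1.1 - T.2).
pose bad (T : C * C * C) := e * per T ^+ 2 < N (tri_int f T.1.1 T.1.2 T.2).
pose inP (T : C * C * C) := [/\ P T.1.1, P T.1.2 & P T.2].
suff : ~ bad (a, b, c) by rewrite /bad /per /=; move=> /negP; rewrite -leNgt.
move=> Hbad.
pose t1 (T : C * C * C) := (T.1.1, (T.1.1 + T.1.2) / 2, (T.2 + T.1.1) / 2).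
pose t2 (T : C * C * C) := ((T.1.1 + T.1.2) / 2, T.1.2, (T.1.2 + T.2) / 2).
pose t3 (T : C * C * C) := ((T.2 + T.1.1) / 2, (T.1.2 + T.2) / 2, T.2).
pose t4 (T : C * C * C) := ((T.1.2 + T.2) / 2, (T.2 + T.1.1) / 2, (T.1.1 + T.1.2) / 2).
pose nxt T := if `[< bad (t1 T) >] then t1 T else if `[< bad (t2 T) >] then t2 T
  else if `[< bad (t3 T) >] then t3 T else t4 T.
have nxtE T : [\/ nxt T = t1 T, nxt T = t2 T, nxt T = t3 T | nxt T = t4 T].
  rewrite /nxt; case: ifP => _; first by constructor 1.
  case: ifP => _; first by constructor 2.
  by case: ifP => _; [constructor 3|constructor 4].
have Pm x y : P x -> P y -> P ((x + y) / 2).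
  by move=> Px Py; apply: (Pc _ _ Px Py); exact: seg_mid.
have nxtP T : inP T -> inP (nxt T).
  move=> [H1 H2 H3]; have [->|->|->|->] := nxtE T; split => /=;
  by [|exact: Pm].
have halfN x y z : 2 * (x - y) = z -> N (x - y) = N z / 2.
  by move=> <-; rewrite Normc.normcM normc2; field.
have per_half T i : [\/ i = t1 T, i = t2 T, i = t3 T | i = t4 T] -> per i = per T / 2.
  move=> [->|->|->|->]; rewrite /per /= [RHS]mulrDl [X in _ = X + _]mulrDl; congr (_ + _ + _);
  first [by apply: halfN; field|by rewrite normc_distC; apply: halfN; field].
have nxt_bad T : inP T -> bad T -> bad (nxt T).
  move=> PT bT; rewrite /nxt.
  case: asboolP => // /negP; rewrite -leNgt => b1.
  case: asboolP => // /negP; rewrite -leNgt => b2.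
  case: asboolP => // /negP; rewrite -leNgt => b3.
  apply: contrapT => /negP; rewrite -leNgt => b4.
  move: bT; rewrite /bad; apply/negP; rewrite -leNgt.
  have [H1 H2 H3] := PT; rewrite (tri_int_mid Pc cf H1 H2 H3).
  move: b1 b2 b3 b4; rewrite (per_half T (t1 T)); last by constructor 1.
  rewrite (per_half T (t2 T)); last by constructor 2.
  rewrite (per_half T (t3 T)); last by constructor 3.
  rewrite (per_half T (t4 T)); last by constructor 4.
  move=> b1 b2 b3 b4.
  apply: le_trans (normcD _ _) _; apply: le_trans (lerD (normcD _ _) (lexx _)) _.
  apply: le_trans (lerD (lerD (normcD _ _) (lexx _)) (lexx _)) _.
  move: b1 b2 b3 b4; rewrite /t1 /t2 /t3 /t4 /= expr_div_n.
  have -> : (2 : R) ^+ 2 = 4 by ring.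
  lra.
pose T k := iter k nxt (a, b, c).
have PT k : inP (T k) by elim: k => [//|k IH]; exact: nxtP.
have bT k : bad (T k) by elim: k => [//|k IH]; apply: nxt_bad.
have perT k : per (T k) = per (a, b, c) * 2^-1 ^+ k.
  elim: k => [|k IH]; first by rewrite expr0 mulr1.
  by rewrite exprSr mulrA -IH /= (per_half (T k)).
have per_ge T' : [/\ N (T'.1.2 - T'.1.1) <= per T', N (T'.2 - T'.1.2) <= per T',
    N (T'.1.1 - T'.2) <= per T' & 0 <= per T'].
  have := normc_ge0 (T'.1.2 - T'.1.1); have := normc_ge0 (T'.2 - T'.1.2).
  by have := normc_ge0 (T'.1.1 - T'.2); rewrite /per; split; lra.
have [k|z cz Hz] := @geom_limit R (fun k => (T k).1.1) (per (a, b, c)).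
  rewrite -perT; apply: le_trans (_ : per (T k) / 2 <= _); last first.
    by have [_ _ _] := per_ge (T k); lra.
  have [_ _ p31 _] := per_ge (T k); have [p12 _ _ p0] := per_ge (T k).
  rewrite /=; have [->|->|->|->] := nxtE (T k) => /=.
  - by rewrite subrr Normc.normc0; lra.
  - by rewrite mid_distl; lra.
  - rewrite (addrC (T k).2) mid_distl normc_distC; lra.
  - rewrite (halfN _ _ (((T k).1.2 - (T k).1.1) + ((T k).2 - (T k).1.1))); last by field.
    have [p12' p23 _ _] := per_ge (T k).
    have := normcD ((T k).1.2 - (T k).1.1) ((T k).2 - (T k).1.1).
    have := normc_ge0 ((T k).2 - (T k).1.2).
    have := normc_distC (T k).2 (T k).1.1; rewrite /per; lra.
have Pz : P z by apply: (closed_limit Pcl _ cz) => k; case: (PT k).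
have dz := derivableP (df z Pz); set l := 'D_1 f z in dz.
(* Points of the small triangle are within [3 * p] of [z], so the errors add up to
   [3 * e' * p ^+ 2], which is below [e * p ^+ 2] with room to spare. *)
pose e' := e / 4.
have [d d0 Hd] := (is_deriveCP f z l).1 dz e' ltac:(by rewrite divr_gt0).
have [k Hk] := half_cvg0 (4 * per (a, b, c)) d0.
have {}Hk : 4 * per (T k) <= d by rewrite perT mulrA; exact: Hk.
have [p12 p23 p31 p0] := per_ge (T k).
have zk : N (z - (T k).1.1) <= 2 * per (T k) by rewrite perT mulrA; exact: Hz.
have [P1 P2 P3] := PT k.
set A := (T k).1.1 in p12 p31 zk P1; set B := (T k).1.2 in p12 p23 P2.
set D := (T k).2 in p23 p31 P3; set p := per (T k) in Hk p12 p23 p31 p0 zk.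
have near x y w : P x -> P y -> N (x - A) + N (y - x) <= p -> seg x y w ->
    N (f w - ((f z - l * z) + l * w)) <= e' * (3 * p).
  move=> Px Py xy /seg_dist xw.
  have wz : N (w - z) <= 3 * p.
    have := normc_split x w z; have := normc_split A x z.
    by rewrite (normc_distC A z); lra.
  have -> : f w - (f z - l * z + l * w) = f w - f z - l * (w - z) by ring.
  apply: le_trans (Hd w _) _; first by lra.
  by rewrite ler_wpM2l// /e'; lra.
have step x y : P x -> P y -> N (x - A) + N (y - x) <= p ->
    N (seg_int f x y - ((f z - l * z) * (y - x) + l * (y ^+ 2 - x ^+ 2) / 2))
      <= e' * (3 * p) * N (y - x).
  move=> Px Py xy; apply: seg_int_affine_le; last by move=> w; exact: near.
  by apply: cont_onS cf; exact: Pc.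
have perE : p = N (B - A) + N (D - B) + N (A - D) by [].
have n1 := normc_ge0 (B - A); have n2 := normc_ge0 (D - B).
have n3 := normc_ge0 (A - D).
have s1 := step A B P1 P2 ltac:(by rewrite subrr Normc.normc0; lra).
have s2 := step B D P2 P3 ltac:(lra).
have s3 := step D A P3 P1 ltac:(rewrite (normc_distC D A); have := normc_split B A D;
  have := normc_distC A B; have := normc_distC B D; lra).
have := bT k; rewrite /bad -/p; apply/negP; rewrite -leNgt /tri_int -/A -/B -/D.
apply: (@le_trans _ _ (e' * (3 * p) * p)); last first.
  by rewrite /e'; have := sqr_ge0 p; rewrite expr2 => pp; nra.
have -> : e' * (3 * p) * p = e' * (3 * p) * N (B - A) + e' * (3 * p) * N (D - B) +
    e' * (3 * p) * N (A - D) by rewrite -!mulrDr -perE.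
apply: le_trans _ (lerD (lerD s1 s2) s3).
apply: le_trans _ (lerD (normcD _ _) (lexx _)); apply: le_trans _ (normcD _ _).
(* The affine parts cancel around the closed path. *)
rewrite le_eqVlt; apply/orP; left; apply/eqP; congr (N _).
by field.
Qed.

Lemma cauchy_triangle f (P : set C) a b c : convex_subset P -> closed P ->
  (forall x, P x -> derivable f x 1) -> P a -> P b -> P c -> tri_int f a b c = 0.
Proof.
move=> Pc Pcl df Pa Pb Pd; apply: Normc.eq0_normc; apply/eqP.
rewrite eq_le normc_ge0 andbT; apply/ler_addgt0Pr => e e0; rewrite add0r.
set p := N (b - a) + N (c - b) + N (a - c).
have p1 : 0 < p ^+ 2 + 1 by rewrite ltr_wpDl ?sqr_ge0.
apply: le_trans (cauchy_triangle_le Pc Pcl df Pa Pb Pd (divr_gt0 e0 p1)) _.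
by rewrite -/p mulrAC ler_pdivrMr// ler_wpM2l ?lerDl// ltW.
Qed.

End Integral.

(** * Cauchy's formula on squares *)

Section Square.
Variable R : realType.
Local Notation C := R[i].
Local Notation N := (@Normc.normc R).
Local Notation Re := complex.Re.
Local Notation Im := complex.Im.
Local Notation ii := ('i%C : C).
Implicit Types (a b c x y z w o v e : C) (r s t d : R) (f g : C -> C) (j k n : nat).

(** Cut the quadrilateral along the diagonal from [a] to [b'] and apply Cauchy's theorem to both
    triangles. *)
Lemma quad_int f (P : set C) a b a' b' : convex_subset P -> closed P ->
  (forall x, P x -> derivable f x 1) -> P a -> P b -> P a' -> P b' ->
  seg_int f a b - seg_int f a' b' = seg_int f a a' - seg_int f b b'.
Proof.
move=> Pc Pcl df Pa Pb Pa' Pb'.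
have cs x y : P x -> P y -> cont_on (seg x y) f.
  move=> Px Py z /(Pc _ _ Px Py) /df H.
  by apply: is_derive_cont; exact: derivableP H.
have t1 := cauchy_triangle Pc Pcl df Pa Pb Pb'.
have t2 := cauchy_triangle Pc Pcl df Pa Pb' Pa'.
rewrite /tri_int (seg_intN (cs _ _ Pa Pb')) in t1.
rewrite /tri_int (seg_intN (cs _ _ Pa Pa')) (seg_intN (cs _ _ Pa' Pb')) in t2.
apply/eqP; rewrite -subr_eq0; apply/eqP.
transitivity ((seg_int f a b + seg_int f b b' - seg_int f a b') +
  (seg_int f a b' - seg_int f a' b' - seg_int f a a')); first by ring.
by rewrite t1 t2 addr0.
Qed.

(** A closed disc cut by a half-plane. For [d > 0] it is a closed convex set that avoids [e], so
    Cauchy's theorem applies on it to functions with a singularity at [e]. *)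
Definition region o r v e d : set C :=
  [set x | N (x - o) <= r /\ d <= Re (v * (x - e))].

Lemma region_convex o r v e d : convex_subset (region o r v e d).
Proof.
move=> a b [ar ad] [br bd] _ [t /andP[t0 t1] ->]; split.
  have -> : a + t%:C%C * (b - a) - o = (1 - t)%:C%C * (a - o) + t%:C%C * (b - o).
    by rewrite rmorphB rmorph1; ring.
  apply: le_trans (normcD _ _) _.
  rewrite !Normc.normcM !normc_real !ger0_norm ?subr_ge0//.
  by nra.
have -> : v * (a + t%:C%C * (b - a) - e) =
    (1 - t)%:C%C * (v * (a - e)) + t%:C%C * (v * (b - e)).
  by rewrite rmorphB rmorph1; ring.
by rewrite ReD !Re_realM; nra.
Qed.

Lemma region_closed o r v e d : closed (region o r v e d).
Proof.
move=> x clx.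
have H t : 0 < t -> exists2 y, region o r v e d y & N (y - x) < t.
  move=> t0; have [|y [Hy yx]] := clx [set y | N (y - x) < t].
    by apply/nbhs_normcP; exists t.
  by exists y.
split.
  apply/ler_addgt0Pl => t t0; have [y [yr _] yx] := H t t0.
  by have := normc_split y x o; rewrite (normc_distC x y); lra.
apply/ler_addgt0Pl => t t0.
have v1 : 0 < N v + 1 by rewrite ltr_wpDl ?normc_ge0.
have [y [_ yd] yx] := H _ (divr_gt0 t0 v1).
have -> : v * (x - e) = v * (y - e) - v * (y - x) by ring.
rewrite ReB; have := Re_le (v * (y - x)); rewrite Normc.normcM.
move: yx; rewrite ltr_pdivlMr//; have := normc_ge0 (y - x); have := normc_ge0 v.
by nra.
Qed.

(** Counterclockwise corners, from the lower right one, of the square with centre [w] and half-side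
    [s]; side [j] is the right-hand side turned by [ii ^+ j]. *)
Definition corner w s j : C := w + s%:C%C * (ii ^+ j * (1 - ii)).

Definition sq_int f w s := \sum_(0 <= j < 4) seg_int f (corner w s j) (corner w s j.+1).

Lemma sqri : ii * ii = -1. Proof. by rewrite -expr2 sqr_i. Qed.

Lemma normci : N ii = 1.
Proof. by rewrite /= expr0n expr1n add0r sqrtr1. Qed.

Lemma norm1Bi : N (1 - ii) <= 2.
Proof. by have := normcB 1 ii; rewrite normci Normc.normc1; lra. Qed.

Lemma iexp_mulNi j : (- ii) ^+ j * ii ^+ j = 1.
Proof. by rewrite -exprMn mulNr sqri opprK expr1n. Qed.

Lemma normcNi j : N ((- ii) ^+ j) = 1.
Proof. by rewrite normcX normc_opp normci expr1n. Qed.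

Lemma cornerS w s j : corner w s j.+1 = w + s%:C%C * (ii ^+ j * (1 + ii)).
Proof.
rewrite /corner exprSr; congr (_ + _ * _); rewrite -mulrA; congr (_ * _).
by rewrite mulrBr mulr1 sqri opprK addrC.
Qed.

Lemma corner4 w s : corner w s 4 = corner w s 0.
Proof. by rewrite /corner (exprM ii 2 2) sqr_i sqrrN expr1n expr0. Qed.

(** Multiplication by [(- ii) ^+ j] turns side [j] back into the right-hand vertical side, where the
    real part is constant. *)
Lemma Re_corner w s j e : Re ((- ii) ^+ j * (corner w s j - e)) =
  s + Re ((- ii) ^+ j * (w - e)).
Proof.
have -> : (- ii) ^+ j * (corner w s j - e) =
   s%:C%C * (((- ii) ^+ j * ii ^+ j) * (1 - ii)) + (- ii) ^+ j * (w - e).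
  by rewrite /corner; ring.
by rewrite iexp_mulNi mul1r ReD Re_realM ReB /= subr0 mulr1.
Qed.

Lemma Re_cornerS w s j e : Re ((- ii) ^+ j * (corner w s j.+1 - e)) =
  s + Re ((- ii) ^+ j * (w - e)).
Proof.
have -> : (- ii) ^+ j * (corner w s j.+1 - e) =
   s%:C%C * (((- ii) ^+ j * ii ^+ j) * (1 + ii)) + (- ii) ^+ j * (w - e).
  by rewrite cornerS; ring.
by rewrite iexp_mulNi mul1r ReD Re_realM ReD /= addr0 mulr1.
Qed.

Lemma corner_dist w s j : 0 <= s -> N (corner w s j - w) <= 2 * s.
Proof.
move=> s0; rewrite addrC addKr !Normc.normcM normc_real ger0_norm// normcX normci.
by rewrite expr1n mul1r mulrC ler_wpM2r// norm1Bi.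
Qed.

Lemma side_len w s j : 0 <= s -> N (corner w s j.+1 - corner w s j) = 2 * s.
Proof.
move=> s0; rewrite cornerS /corner.
have -> : w + s%:C%C * (ii ^+ j * (1 + ii)) - (w + s%:C%C * (ii ^+ j * (1 - ii))) =
   s%:C%C * (ii ^+ j * (2 * ii)) by ring.
rewrite !Normc.normcM normc_real ger0_norm// normcX normci normc2.
by rewrite expr1n mul1r mulr1 mulrC.
Qed.

(** For each [j], the [j]-th sides of the two squares and the segments joining their ends lie in one
    half-plane that misses [e]. There the two side integrals differ only by integrals over joining
    segments, and these cancel around the square. *)
Lemma sq_int_shift f o r (e w1 w2 : C) s1 s2 :
  (forall x, N (x - o) <= r -> x != e -> derivable f x 1) ->
  N (w1 - e) < s1 -> N (w2 - e) < s2 ->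
  N (w1 - o) + 2 * s1 <= r -> N (w2 - o) + 2 * s2 <= r ->
  sq_int f w1 s1 = sq_int f w2 s2.
Proof.
move=> df we1 we2 wo1 wo2; apply/eqP; rewrite -subr_eq0; apply/eqP.
rewrite /sq_int -sumrB.
(* [s - N (w - e)] is a lower bound for the distance from [e] to the line of each side. *)
pose d := Num.min (s1 - N (w1 - e)) (s2 - N (w2 - e)).
have d0 : 0 < d by rewrite lt_min !subr_gt0 we1 we2.
have s10 : 0 <= s1 by have := normc_ge0 (w1 - e); lra.
have s20 : 0 <= s2 by have := normc_ge0 (w2 - e); lra.
(* The joining segments telescope, since corner 4 is corner 0. *)
transitivity (\sum_(0 <= j < 4) ((- seg_int f (corner w1 s1 j.+1) (corner w2 s2 j.+1))
   - (- seg_int f (corner w1 s1 j) (corner w2 s2 j)))); last first.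
  by rewrite telescope_sumr// !corner4 subrr.
apply: eq_bigr => j _; rewrite opprK [RHS]addrC.
have inr w s i : N (w - o) + 2 * s <= r -> 0 <= s -> N (corner w s i - o) <= r.
  move=> wr s0; apply: le_trans (normc_split w _ _) _.
  by have := corner_dist w i s0; lra.
have Rb w : - N (w - e) <= Re ((- ii) ^+ j * (w - e)).
  have := normc_Re ((- ii) ^+ j * (w - e)); rewrite Normc.normcM normcNi mul1r.
  by rewrite ler_norml => /andP[].
have dm : (d <= s1 - N (w1 - e)) /\ (d <= s2 - N (w2 - e)).
  by split; rewrite ge_min lexx ?orbT.
have [dm1 dm2] := dm; have R1 := Rb w1; have R2 := Rb w2.
apply: (@quad_int f (region o r ((- ii) ^+ j) e d)).
- exact: region_convex.
- exact: region_closed.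
- move=> x [xo xe]; apply: df => //; apply/eqP => xe'.
  by move: xe; rewrite xe' subrr mulr0 /=; lra.
- by split; [exact: inr|rewrite Re_corner; lra].
- by split; [exact: inr|rewrite Re_cornerS; lra].
- by split; [exact: inr|rewrite Re_corner; lra].
- by split; [exact: inr|rewrite Re_cornerS; lra].
Qed.

(** It contains the square of half-side [s] around [w]; the outer factor 2 is a rational substitute
    for the square root of 2. *)
Definition annulus w s : set C := [set x | s <= N (x - w) <= 2 * s].

Lemma side_annulus w s j : 0 <= s -> seg (corner w s j) (corner w s j.+1) `<=` annulus w s.
Proof.
move=> s0 x Hx.
have : region w (2 * s) ((- ii) ^+ j) w s x.
  apply: (region_convex _ _ Hx); split; rewrite ?corner_dist//.
    by rewrite Re_corner subrr mulr0 addr0.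
  by rewrite Re_cornerS subrr mulr0 addr0.
move=> [xw Rx]; apply/andP; split => //; apply: le_trans Rx _.
by apply: le_trans (Re_le _) _; rewrite Normc.normcM normcNi mul1r.
Qed.

Lemma sq_int_lin f g c w s : 0 <= s -> cont_on (annulus w s) f -> cont_on (annulus w s) g ->
  sq_int (fun x => c * f x + g x) w s = c * sq_int f w s + sq_int g w s.
Proof.
move=> s0 cf cg; rewrite /sq_int mulr_sumr -big_split /=; apply: eq_bigr => j _.
by apply: seg_int_lin; [apply: cont_onS cf|apply: cont_onS cg]; exact: side_annulus.
Qed.

Lemma sq_int_ext f g w s : 0 <= s -> (forall x, annulus w s x -> f x = g x) ->
  sq_int f w s = sq_int g w s.
Proof.
move=> s0 fg; apply: eq_bigr => j _; apply: seg_int_ext => x /(side_annulus s0); exact: fg.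
Qed.

Lemma sq_int_le f (M : R) w s : 0 <= s -> cont_on (annulus w s) f ->
  (forall x, annulus w s x -> N (f x) <= M) -> N (sq_int f w s) <= M * (8 * s).
Proof.
move=> s0 cf fM.
have H j : N (seg_int f (corner w s j) (corner w s j.+1)) <= M * (2 * s).
  rewrite -(side_len w j s0); apply: seg_int_le.
    by apply: cont_onS cf; exact: side_annulus.
  by move=> x /(side_annulus s0); exact: fM.
rewrite /sq_int !big_nat_recr//= big_geq// add0r.
have -> : M * (8 * s) = M * (2 * s) + M * (2 * s) + M * (2 * s) + M * (2 * s) by ring.
do 3! (apply: le_trans (normcD _ _) _; apply: lerD (H _)).
exact: H.
Qed.

(* The value is [2 * pi * 'i], but only a positive lower bound of its modulus matters. *)
Definition twopii : C := 4 * seg_int (fun x => x^-1) (1 - ii) (1 + ii).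

(** The differential [dx / (x - w)] is invariant under affine maps fixing the pole, already at each
    finite level; so all sides of all squares contribute the same integral. *)
Lemma dsum_inv w c k a b : c != 0 ->
  dsum (fun x => (x - w)^-1) k (w + c * a) (w + c * b) = dsum (fun x => x^-1) k a b.
Proof.
move=> c0; elim: k a b => [|k IH] a b /=.
  have -> : (w + c * a + (w + c * b)) / 2 - w = c * ((a + b) / 2) by field.
  have -> : w + c * b - (w + c * a) = c * (b - a) by ring.
  by rewrite invfM mulrACA divff// mul1r.
have -> : (w + c * a + (w + c * b)) / 2 = w + c * ((a + b) / 2) by field.
by rewrite !IH.
Qed.

Lemma sq_int_inv w s : 0 < s -> sq_int (fun x => (x - w)^-1) w s = twopii.
Proof.
move=> s0; have sn0 : s%:C%C != 0 :> C by rewrite fmorph_eq0 gt_eqF.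
have H j : seg_int (fun x => (x - w)^-1) (corner w s j) (corner w s j.+1) =
    seg_int (fun x => x^-1) (1 - ii) (1 + ii).
  rewrite cornerS /corner !mulrA; congr (limn _); apply/funext => k.
  by apply: dsum_inv; rewrite mulf_neq0// expf_neq0// -normc_eq0 normci oner_eq0.
rewrite /sq_int !big_nat_recr//= big_geq// !H /twopii; ring.
Qed.

Lemma dsum0 f a b : dsum f 0 a b = (b - a) * f ((a + b) / 2).
Proof. by []. Qed.

Lemma dsumS f k a b :
  dsum f k.+1 a b = dsum f k a ((a + b) / 2) + dsum f k ((a + b) / 2) b.
Proof. by []. Qed.

Lemma mid_vertical (t1 t2 : R) :
  ((1 +i* t1)%C + (1 +i* t2)%C) / 2 = (1 +i* ((t1 + t2) / 2))%C.
Proof.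
rewrite -half2 mulrC; apply/eqP; rewrite eq_complex /=.
by apply/andP; split; apply/eqP; field.
Qed.

(** On the line of real part 1 the imaginary part of [dx / x] is [dt / (1 + t ^+ 2)], at least
    [dt / 2] for [t] in [[-1, 1]]. *)
Lemma Im_dsum_inv k (t1 t2 : R) : -1 <= t1 -> t1 <= t2 -> t2 <= 1 ->
  (t2 - t1) / 2 <= Im (dsum (fun x : C => x^-1) k (1 +i* t1)%C (1 +i* t2)%C).
Proof.
elim: k t1 t2 => [|k IH] t1 t2 h1 h2 h3; last first.
  rewrite dsumS mid_vertical ImD.
  by have := IH t1 ((t1 + t2) / 2); have := IH ((t1 + t2) / 2) t2; lra.
rewrite dsum0 mid_vertical; set t := (t1 + t2) / 2.
have t1' : t ^+ 2 <= 1 by rewrite /t; nra.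
have t0 : 0 < 1 + t ^+ 2 by rewrite ltr_wpDr ?sqr_ge0.
have -> : Im (((1 +i* t2)%C - (1 +i* t1)%C) * (1 +i* t)%C^-1) = (t2 - t1) / (1 + t ^+ 2).
  by rewrite /= expr1n; field; rewrite gt_eqF.
by rewrite ler_wpM2l ?subr_ge0// lef_pV2 ?posrE//; lra.
Qed.

Lemma seg_i y : seg (1 - ii) (1 + ii) y -> y != 0.
Proof.
move=> [t _ ->]; apply/eqP => /(congr1 (@complex.Re R)) /eqP.
by rewrite !(ReD, ReB) Re_realM !(ReD, ReB) /= => /eqP; lra.
Qed.

Lemma cont_inv x : x != 0 -> {for x, continuous (fun y : C => y^-1)}.
Proof. by move=> x0; apply: continuousV => //; exact: cvg_id. Qed.

Lemma twopii_ge4 : 4 <= N twopii.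
Proof.
have cv := seg_int_cvg (fun y hy => cont_inv (@seg_i y hy)).
have H : 1 <= N (seg_int (fun x => x^-1) (1 - ii) (1 + ii)).
  apply/ler_addgt0Pl => e e0; have [n Hn] := (cvgn_normcP _ _).1 cv e e0.
  have := Hn n (leqnn n); rewrite normc_distC => {}Hn.
  apply: le_trans (_ : 1 <= N (dsum (fun x => x^-1) n (1 - ii) (1 + ii))) _.
    apply: le_trans (le_trans (ler_norm _) (normc_Im _)).
    have -> : 1 - ii = (1 +i* -1)%C by apply/eqP; rewrite eq_complex /= subr0 sub0r !eqxx.
    have -> : 1 + ii = (1 +i* 1)%C by apply/eqP; rewrite eq_complex /= addr0 add0r !eqxx.
    by have := @Im_dsum_inv n (-1) 1; lra.
  have := normcBr (dsum (fun x => x^-1) n (1 - ii) (1 + ii))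
    (seg_int (fun x => x^-1) (1 - ii) (1 + ii)).
  by rewrite normc_distC in Hn; lra.
by rewrite /twopii Normc.normcM normc_nat; lra.
Qed.

Lemma twopii_neq0 : twopii != 0.
Proof. by rewrite -normc_gt0; have := twopii_ge4; lra. Qed.

(** * Cauchy's integral formula *)

Lemma derivable_div f g x : derivable f x 1 -> derivable g x 1 -> g x != 0 ->
  derivable (fun y => f y / g y) x 1.
Proof.
move=> df dg g0; change (derivable (f * (fun y => (g y)^-1)) x 1).
by apply: derivableM; [exact: df|exact: derivableV].
Qed.

Lemma derivableBC w x : derivable (fun y : C => y - w) x 1.
Proof.
change (derivable ((fun y : C => y) - (fun=> w)) x 1).
by apply: derivableB; [exact: derivable_id|exact: derivable_cst].
Qed.

Lemma derivable_pole f w x : derivable f x 1 -> x != w ->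
  derivable (fun y => f y / (y - w)) x 1.
Proof.
move=> df xw; have dw := @derivableBC w x.
have xw0 : x - w != 0 by rewrite subr_eq0.
exact: (@derivable_div f (fun y => y - w) x df dw xw0).
Qed.

Lemma derivable_cont f x : derivable f x 1 -> {for x, continuous f}.
Proof. by move=> H; apply: is_derive_cont; exact: derivableP H. Qed.

Lemma annulus_neq w s x : 0 < s -> annulus w s x -> x != w.
Proof.
move=> s0 /andP[h _]; apply: contraTneq h => ->.
by rewrite subrr Normc.normc0 -ltNge.
Qed.

(** The square is moved to a tiny one centred at [w], where [f] is nearly the constant [f w]. *)
Lemma cauchy_formula f o r s w :
  (forall x, N (x - o) <= r -> derivable f x 1) ->
  2 * s <= r -> N (w - o) < s ->
  sq_int (fun x => f x / (x - w)) o s = twopii * f w.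
Proof.
move=> df sr wo; apply/eqP; rewrite -subr_eq0 -normc_eq0 eq_le normc_ge0 andbT.
have s0 : 0 < s by have := normc_ge0 (w - o); lra.
apply/ler_addgt0Pr => t t0; rewrite add0r.
have wr : N (w - o) <= r by lra.
have [d d0 Hd] := (continuous_normcP f w).1 (derivable_cont (df w wr)) (t / 8) ltac:(lra).
(* The first bound keeps the new annulus inside the continuity disc, the second inside the disc of
   holomorphy. The perimeter [8 * s2] then cancels against the error [t / 8 / s2]. *)
pose s2 := Num.min (d / 4) (s / 2).
have [s2d s2s] : s2 <= d / 4 /\ s2 <= s / 2 by split; rewrite ge_min lexx ?orbT.
have s20 : 0 < s2 by rewrite lt_min; apply/andP; split; lra.
have inr x : annulus w s2 x -> N (x - o) <= r.
  move=> /andP[_ h]; have := normc_split w x o; lra.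
rewrite (@sq_int_shift _ o r w o w s s2); first last.
- by lra.
- by rewrite subrr Normc.normc0; lra.
- by rewrite subrr Normc.normc0.
- by rewrite normc_distC.
- by move=> x /df dfx xw; exact: derivable_pole.
have cpole (c : C) : cont_on (annulus w s2) (fun x => c / (x - w)).
  move=> x Hx; apply: derivable_cont; apply: (@derivable_pole (fun _ => c)).
    exact: derivable_cst.
  exact: annulus_neq Hx.
have cF : cont_on (annulus w s2) (fun x => f x / (x - w)).
  move=> x Hx; apply: derivable_cont; apply: derivable_pole.
    by apply: df; exact: inr.
  exact: annulus_neq Hx.
have -> : sq_int (fun x => f x / (x - w)) w s2 - twopii * f w =
    sq_int (fun x => - f w * (1 / (x - w)) + f x / (x - w)) w s2.
  rewrite (sq_int_lin _ (ltW s20) (cpole 1) cF).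
  have -> : sq_int (fun x => 1 / (x - w)) w s2 = twopii.
    rewrite -(sq_int_inv w s20); apply: sq_int_ext; first exact: ltW.
    by move=> x _; rewrite mul1r.
  by ring.
apply: le_trans (@sq_int_le _ (t / 8 / s2) w s2 (ltW s20) _ _) _.
- move=> x Hx; apply: continuousD; last exact: cF.
  by apply: continuousM; [exact: cst_continuous|exact: cpole].
- move=> x Hx; have -> : - f w * (1 / (x - w)) + f x / (x - w) = (f x - f w) / (x - w).
    by ring.
  rewrite normc_div; move: Hx => /andP[h1 h2]; apply: ler_pM; rewrite ?invr_ge0 ?normc_ge0//.
    by apply: Hd; lra.
  by rewrite lef_pV2 ?posrE//; lra.
by rewrite le_eqVlt; apply/orP; left; apply/eqP; field; rewrite gt_eqF.
Qed.

End Square.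

(** * Taylor's formula *)

Section Taylor.
Variable R : realType.
Local Notation C := R[i].
Local Notation N := (@Normc.normc R).
Local Notation Re := complex.Re.
Implicit Types (x y z w o p : C) (r s t d : R) (f g k : C -> C) (m n : nat).

Definition coef f o s m : C := sq_int (fun x => f x / (x - o) ^+ m.+1) o s / twopii R.

(** Cauchy's integral form of the remainder after [n] terms, with [(w - o) ^+ n] factored out. As
    the formula is exact, no convergence of power series is needed. *)
Definition taylor_rem f o s n w : C :=
  sq_int (fun x => f x / ((x - o) ^+ n * (x - w))) o s / twopii R.

Lemma derivableXB o n x : derivable (fun y : C => (y - o) ^+ n) x 1.
Proof.
elim: n => [|n IH].
  by under eq_fun do rewrite expr0; exact: derivable_cst.
have -> : (fun y : C => (y - o) ^+ n.+1) = (fun y : C => y - o) * (fun y : C => (y - o) ^+ n).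
  by apply/funext => y; rewrite exprS.
by apply: derivableM; [exact: derivableBC|exact: IH].
Qed.

Section OnDisc.
Variables (f : C -> C) (o : C) (r : R).
Hypothesis df : forall x, N (x - o) <= r -> derivable f x 1.

Let annulus_disc s x : 2 * s <= r -> annulus o s x -> N (x - o) <= r.
Proof. by move=> sr /andP[_ h]; exact: le_trans sr. Qed.

Let near_annulus s w x : annulus o s x -> N (w - o) <= s / 2 -> s / 2 <= N (x - w).
Proof.
by move=> /andP[h _] wo; have := normc_split w x o; lra.
Qed.

Let pole_cont s m n w : 0 < s -> 2 * s <= r -> N (w - o) <= s / 2 ->
  cont_on (annulus o s) (fun x => f x / ((x - o) ^+ m * (x - w) ^+ n)).
Proof.
move=> s0 sr wo x Hx; apply: derivable_cont.
have dx : derivable f x 1 by apply: df; exact: annulus_disc Hx.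
have xo : x - o != 0 by rewrite subr_eq0; exact: annulus_neq Hx.
have xw : x - w != 0 by rewrite -normc_gt0; have := near_annulus Hx wo; lra.
have g0 : (x - o) ^+ m * (x - w) ^+ n != 0 by rewrite mulf_neq0// expf_neq0.
have dg := @derivableM _ _ (fun y : C => (y - o) ^+ m) (fun y => (y - w) ^+ n) x 1
  (@derivableXB o m x) (@derivableXB w n x).
exact: (@derivable_div R f (fun y => (y - o) ^+ m * (y - w) ^+ n) x dx dg g0).
Qed.

Let center s : 0 < s -> N (o - o) <= s / 2.
Proof. by rewrite subrr Normc.normc0; lra. Qed.

Lemma taylor_rem0 s w : 0 < s -> 2 * s <= r -> N (w - o) <= s / 2 -> taylor_rem f o s 0 w = f w.
Proof.
move=> s0 sr wo; rewrite /taylor_rem.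
under eq_fun do rewrite expr0 mul1r.
rewrite (cauchy_formula df sr); last by lra.
by rewrite mulrAC divff ?mul1r// twopii_neq0.
Qed.

(** From [1 / (x - w) = 1 / (x - o) + (w - o) / ((x - o) * (x - w))] under the integral. *)
Lemma taylor_remS s n w : 0 < s -> 2 * s <= r -> N (w - o) <= s / 2 ->
  taylor_rem f o s n w = coef f o s n + (w - o) * taylor_rem f o s n.+1 w.
Proof.
move=> s0 sr wo; rewrite /taylor_rem /coef mulrA -mulrDl addrC; congr (_ / _).
have c1 : cont_on (annulus o s) (fun x => f x / ((x - o) ^+ n.+1 * (x - w))).
  by have := @pole_cont s n.+1 1 w s0 sr wo; under eq_fun do rewrite expr1.
have c2 : cont_on (annulus o s) (fun x => f x / (x - o) ^+ n.+1).
  have := @pole_cont s n.+1 0 w s0 sr wo.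
  by under eq_fun do rewrite expr0 mulr1.
rewrite -sq_int_lin//; last exact: ltW.
apply: sq_int_ext; first exact: ltW.
move=> x Hx; rewrite exprS.
have xo : x - o != 0 by rewrite subr_eq0; exact: annulus_neq Hx.
have xw : x - w != 0.
  by rewrite -normc_gt0; have := near_annulus Hx wo; lra.
have xn : (x - o) ^+ n != 0 by rewrite expf_neq0.
by field; rewrite xo xw xn.
Qed.

Lemma taylor s n w : 0 < s -> 2 * s <= r -> N (w - o) <= s / 2 ->
  f w = \sum_(0 <= m < n) coef f o s m * (w - o) ^+ m + (w - o) ^+ n * taylor_rem f o s n w.
Proof.
move=> s0 sr wo; elim: n => [|n IH].
  by rewrite big_geq// expr0 mul1r add0r taylor_rem0.
rewrite {1}IH big_nat_recr//= -addrA; congr (_ + _).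
by rewrite taylor_remS// exprS; ring.
Qed.

(** Cauchy's estimate; the 2 is the perimeter [8 * s] over the lower bound 4 for [twopii]. *)
Lemma coef_le s m (M : R) : 0 < s -> 2 * s <= r ->
  (forall x, N (x - o) <= r -> N (f x) <= M) -> N (coef f o s m) <= 2 * M / s ^+ m.
Proof.
move=> s0 sr fM; have M0 : 0 <= M.
  by apply: le_trans (fM o _); rewrite ?normc_ge0// subrr Normc.normc0; lra.
rewrite /coef normc_div ler_pdivrMr; last by rewrite normc_gt0 twopii_neq0.
apply: le_trans (_ : M / s ^+ m.+1 * (8 * s) <= _).
  apply: sq_int_le; first exact: ltW.
    have := @pole_cont s m.+1 0 o s0 sr (center s0).
    by under eq_fun do rewrite expr0 mulr1.
  move=> x Hx; rewrite normc_div normcX; apply: ler_pM;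
    rewrite ?normc_ge0 ?invr_ge0 ?exprn_ge0 ?normc_ge0//.
    by apply: fM; exact: annulus_disc Hx.
  move: Hx => /andP[h _]; rewrite lef_pV2 ?posrE ?exprn_gt0//; last by lra.
  by apply: lerXn2r => //; rewrite ?nnegrE ?normc_ge0// ltW.
have sm : 0 < s ^+ m by rewrite exprn_gt0.
have -> : M / s ^+ m.+1 * (8 * s) = 2 * M / s ^+ m * 4.
  by rewrite exprS; field; rewrite !gt_eqF.
by rewrite ler_wpM2l ?twopii_ge4// divr_ge0 ?mulr_ge0// ltW.
Qed.

Lemma taylor_rem_le s n w (M : R) : 0 < s -> 2 * s <= r -> N (w - o) <= s / 2 ->
  (forall x, N (x - o) <= r -> N (f x) <= M) -> N (taylor_rem f o s n w) <= 4 * M / s ^+ n.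
Proof.
move=> s0 sr wo fM; have M0 : 0 <= M.
  by apply: le_trans (fM o _); rewrite ?normc_ge0// subrr Normc.normc0; lra.
rewrite /taylor_rem normc_div ler_pdivrMr; last by rewrite normc_gt0 twopii_neq0.
have sm : 0 < s ^+ n by rewrite exprn_gt0.
apply: le_trans (_ : M / (s ^+ n * (s / 2)) * (8 * s) <= _).
  apply: sq_int_le; first exact: ltW.
    by have := @pole_cont s n 1 w s0 sr wo; under eq_fun do rewrite expr1.
  move=> x Hx; rewrite normc_div Normc.normcM normcX.
  have xw := near_annulus Hx wo.
  apply: ler_pM; rewrite ?normc_ge0 ?invr_ge0 ?mulr_ge0 ?exprn_ge0 ?normc_ge0//.
    by apply: fM; exact: annulus_disc Hx.
  move: Hx => /andP[h _]; rewrite lef_pV2 ?posrE ?mulr_gt0 ?exprn_gt0//; try lra.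
  apply: ler_pM; rewrite ?exprn_ge0//; try lra.
  by apply: lerXn2r => //; rewrite ?nnegrE ?normc_ge0// ltW.
have -> : M / (s ^+ n * (s / 2)) * (8 * s) = 4 * M / s ^+ n * 4.
  by field; rewrite !gt_eqF.
by rewrite ler_wpM2l ?twopii_ge4// divr_ge0 ?mulr_ge0// ltW.
Qed.

Lemma coef_indep s s' m : 0 < s -> 2 * s <= r -> 0 < s' -> 2 * s' <= r ->
  coef f o s m = coef f o s' m.
Proof.
move=> s0 sr s0' sr'; rewrite /coef; congr (_ / _).
apply: (@sq_int_shift _ _ o r o); rewrite ?subrr ?Normc.normc0 ?add0r//.
move=> x /df dx xo; have xo' : (x - o) ^+ m.+1 != 0 by rewrite expf_neq0// subr_eq0.
exact: (@derivable_div R f (fun y => (y - o) ^+ m.+1) x dx (@derivableXB o m.+1 x) xo').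
Qed.

Lemma coef0 s : 0 < s -> 2 * s <= r -> coef f o s 0 = f o.
Proof.
move=> s0 sr; rewrite (@taylor s 1 o) ?center//.
by rewrite big_nat1 expr0 mulr1 subrr expr1 mul0r addr0.
Qed.

(** Schwarz's lemma with a lossy constant, read off the first Taylor remainder once the constant
    term vanishes. *)
Lemma schwarz (M : R) w : 0 < r -> f o = 0 ->
  (forall x, N (x - o) <= r -> N (f x) <= M) -> N (w - o) <= r / 4 ->
  N (f w) <= 8 * M * N (w - o) / r.
Proof.
move=> r0 fo fM wr; have s0 : 0 < r / 2 by lra.
have sr : 2 * (r / 2) <= r by lra.
have wo : N (w - o) <= r / 2 / 2 by lra.
rewrite (@taylor (r / 2) 1 w)// big_nat1 coef0// fo mul0r add0r expr1.
rewrite Normc.normcM mulrC.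
have := taylor_rem_le 1 s0 sr wo fM; rewrite expr1 => H.
have -> : 8 * M * N (w - o) / r = 4 * M / (r / 2) * N (w - o).
  by field; rewrite gt_eqF.
by rewrite ler_wpM2r ?normc_ge0.
Qed.

End OnDisc.

(** The first [n] coefficients are bounded by [t] through the small disc, the remainder by [M]
    through the large one; [2^-1 ^+ n] arises because [r / 4] is half of the half-side [r / 2]. For
    small [t], fix [n] first to make the last term small. *)
Lemma propagation f o r r' (M t : R) n w :
  (forall x, N (x - o) <= r -> derivable f x 1) -> 0 < r' -> r' <= r ->
  (forall x, N (x - o) <= r -> N (f x) <= M) ->
  (forall x, N (x - o) <= r' -> N (f x) <= t) -> N (w - o) <= r / 4 ->
  N (f w) <= t * (2 * \sum_(0 <= m < n) (r / r') ^+ m) + 4 * M * 2^-1 ^+ n.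
Proof.
move=> df r0' rr' fM ft wr; have r0 : 0 < r by lra.
have s0 : 0 < r / 2 by lra. have sr : 2 * (r / 2) <= r by lra.
have s0' : 0 < r' / 2 by lra. have sr' : 2 * (r' / 2) <= r by lra.
have wo : N (w - o) <= r / 2 / 2 by lra.
have oo : N (o - o) <= r by rewrite subrr Normc.normc0; lra.
have M0 : 0 <= M by apply: le_trans (fM o oo); exact: normc_ge0.
have t0 : 0 <= t.
  by apply: le_trans (ft o _); rewrite ?normc_ge0// subrr Normc.normc0; lra.
rewrite (@taylor f o r df (r / 2) n w)//; apply: le_trans (normcD _ _) _; apply: lerD.
  rewrite mulr_sumr mulr_sumr; elim: n => [|n IH].
    by rewrite !big_geq// Normc.normc0.
  rewrite !big_nat_recr//=; apply: le_trans (normcD _ _) _; apply: lerD => //.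
  (* Moving the contour to the small square lets the bound [t] act on the coefficient. *)
  rewrite (@coef_indep f o r df _ (r' / 2))// Normc.normcM normcX.
  have c : N (coef f o (r' / 2) n) <= 2 * t / (r' / 2) ^+ n.
    apply: (@coef_le f o r') => //; last by lra.
    by move=> x xr; apply: df; lra.
  have -> : t * (2 * (r / r') ^+ n) = 2 * t / (r' / 2) ^+ n * (r / 2) ^+ n.
    by rewrite !expr_div_n; field; rewrite !expf_neq0// gt_eqF.
  apply: ler_pM => //; rewrite ?normc_ge0 ?exprn_ge0 ?normc_ge0//.
  by apply: lerXn2r; rewrite ?nnegrE ?normc_ge0//; lra.
rewrite Normc.normcM normcX.
have -> : 4 * M * 2^-1 ^+ n = (r / 2 / 2) ^+ n * (4 * M / (r / 2) ^+ n).
  by rewrite !expr_div_n exprVn; field; rewrite !expf_neq0// gt_eqF.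
apply: ler_pM; rewrite ?normc_ge0 ?exprn_ge0 ?normc_ge0//; last exact: (@taylor_rem_le f o r).
by apply: lerXn2r; rewrite ?nnegrE ?normc_ge0//; lra.
Qed.
End Taylor.

(** * Derivatives of holomorphic functions *)

Section Consequences.
Variable R : realType.
Local Notation C := R[i].
Local Notation N := (@Normc.normc R).
Local Notation Re := complex.Re.
Implicit Types (x y z w o p h : C) (r s t d : R) (f g k : C -> C) (m n : nat).

Lemma is_derive_quadratic f z l d (K : R) : 0 < d -> 0 <= K ->
  (forall w, N (w - z) < d -> N (f w - f z - l * (w - z)) <= K * N (w - z) ^+ 2) ->
  is_derive z 1 f l.
Proof.
move=> d0 K0 H; apply/is_deriveCP => e e0.
have K1 : 0 < K + 1 by lra.
exists (Num.min d (e / (K + 1))); first by rewrite lt_min d0 divr_gt0.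
move=> w; rewrite lt_min ltr_pdivlMr// => /andP[wd we].
apply: le_trans (H w wd) _; rewrite expr2 mulrA ler_wpM2r ?normc_ge0//.
by have := normc_ge0 (w - z); nra.
Qed.

Lemma is_derive_near f g z l d : 0 < d -> (forall w, N (w - z) < d -> f w = g w) ->
  is_derive z 1 f l -> is_derive z 1 g l.
Proof.
move=> d0 fg /is_deriveCP H; apply/is_deriveCP => e e0.
have [d' d'0 Hd] := H e e0.
exists (Num.min d d'); first by rewrite lt_min d0.
move=> w; rewrite lt_min => /andP[wd wd']; rewrite -!fg//; first exact: Hd.
by rewrite subrr Normc.normc0.
Qed.

Lemma continuous_bounded f o : {for o, continuous f} ->
  exists2 d, 0 < d & forall x, N (x - o) < d -> N (f x) <= N (f o) + 1.
Proof.
move=> /continuous_normcP /(_ 1 ltr01)[d d0 Hd]; exists d => // x /Hd.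
by have := normcBr (f x) (f o); lra.
Qed.

(* Differentiates Cauchy's formula twice under the integral sign. *)
Lemma derivable_derive f o r : 0 < r ->
  (forall x, N (x - o) <= r -> derivable f x 1) -> derivable ('D_1 f) o 1.
Proof.
move=> r0 df.
have oo : N (o - o) = 0 by rewrite subrr Normc.normc0.
have [d d0 Hd] := continuous_bounded (derivable_cont (df o ltac:(lra))).
set M := N (f o) + 1 in Hd.
have M0 : 0 < M by have := normc_ge0 (f o); rewrite /M; lra.
pose s := Num.min (r / 2) (d / 4).
have [sr sd] : s <= r / 2 /\ s <= d / 4 by split; rewrite ge_min lexx ?orbT.
have s0 : 0 < s by rewrite lt_min; apply/andP; split; lra.
have fM x : annulus o s x -> N (f x) <= M by move=> /andP[_ h]; apply: Hd; lra.
have dfa x : annulus o s x -> derivable f x 1.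
  by move=> /andP[_ h]; apply: df; lra.
have cpole m n w : N (w - o) < s ->
    cont_on (annulus o s) (fun x => f x / ((x - o) ^+ m * (x - w) ^+ n)).
  move=> wo x Hx; apply: derivable_cont.
  have xo : x - o != 0 by rewrite subr_eq0; exact: annulus_neq Hx.
  have xw : x - w != 0.
    rewrite -normc_gt0; have := normc_split w x o; case/andP: Hx; lra.
  have g0 : (x - o) ^+ m * (x - w) ^+ n != 0 by rewrite mulf_neq0// expf_neq0.
  have dg := @derivableM _ _ (fun y : C => (y - o) ^+ m) (fun y => (y - w) ^+ n) x 1
    (@derivableXB R o m x) (@derivableXB R w n x).
  exact: (@derivable_div R f (fun y => (y - o) ^+ m * (y - w) ^+ n) x (dfa x Hx) dg g0).
have cpole' n w : N (w - o) < s -> cont_on (annulus o s) (fun x => f x / (x - w) ^+ n).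
  by move=> wo; have := cpole 0%N n w wo; under eq_fun do rewrite expr0 mul1r.
have c4 := twopii_ge4 R; have c0 := twopii_neq0 R.
(* The candidate for the derivative of [f], valid at every [w] near [o]; it is then differentiated
   once more at [o]. *)
pose G w := sq_int (fun x => f x / (x - w) ^+ 2) o s / twopii R.
have lin3 (u v g : C -> C) (a b : C) : cont_on (annulus o s) u -> cont_on (annulus o s) v ->
    cont_on (annulus o s) g ->
    cont_on (annulus o s) (fun x => a * u x + (b * v x + g x)) /\
    sq_int (fun x => a * u x + (b * v x + g x)) o s =
      a * sq_int u o s + (b * sq_int v o s + sq_int g o s).
  move=> cu cv cg.
  have cvg : cont_on (annulus o s) (fun x => b * v x + g x).
    move=> x Hx; apply: continuousD; last exact: cg.
    by apply: continuousM; [exact: cst_continuous|exact: cv].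
  split; last by rewrite sq_int_lin// ?ltW// sq_int_lin// ltW.
  move=> x Hx; apply: continuousD; last exact: cvg.
  by apply: continuousM; [exact: cst_continuous|exact: cu].
have fE w : N (w - o) < s -> f w = sq_int (fun x => f x / (x - w) ^+ 1) o s / twopii R.
  move=> wo; under eq_fun do rewrite expr1.
  rewrite (@cauchy_formula R f o r)//; last by lra.
  by rewrite mulrAC divff// mul1r.
have quot3 (u v g : C -> C) (a b : C) (K : R) : cont_on (annulus o s) u ->
    cont_on (annulus o s) v -> cont_on (annulus o s) g ->
    (forall x, annulus o s x -> N (a * u x + (b * v x + g x)) <= K) ->
    N (a * (sq_int u o s / twopii R) + (b * (sq_int v o s / twopii R) + sq_int g o s / twopii R))
      <= K * (2 * s).
  move=> cu cv cg H; have [cc E] := lin3 u v g a b cu cv cg.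
  have -> : a * (sq_int u o s / twopii R) +
      (b * (sq_int v o s / twopii R) + sq_int g o s / twopii R)
     = sq_int (fun x => a * u x + (b * v x + g x)) o s / twopii R by rewrite E; ring.
  rewrite normc_div ler_pdivrMr ?normc_gt0//.
  apply: le_trans (sq_int_le (ltW s0) cc H) _.
  have K0 : 0 <= K.
    have Ho : annulus o s (o + s%:C%C).
      by rewrite /annulus /= addrC addKr normc_real ger0_norm ?(ltW s0)//; lra.
    by apply: le_trans (H _ Ho); exact: normc_ge0.
  have -> : K * (8 * s) = K * (2 * s) * 4 by ring.
  by rewrite ler_wpM2l// mulr_ge0//; lra.
have dG w : N (w - o) < s / 2 -> is_derive w 1 f (G w).
  (* The 16 comes from the denominator bound [(s / 2) ^+ 2 * (s / 4)], and [2 * s] is the perimeter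
     over 4. *)
  move=> wo; pose K := 16 * M / s ^+ 3 * (2 * s).
  apply: (@is_derive_quadratic _ _ _ (s / 4) K); first by lra.
    by rewrite !mulr_ge0 ?invr_ge0 ?exprn_ge0 ?(ltW M0) ?(ltW s0).
  move=> z zw; have zo : N (z - o) < 3 * s / 4.
    by have := normc_split w z o; lra.
  rewrite (fE w) ?(fE z); try lra.
  have := quot3 (fun x => f x / (x - w) ^+ 1) (fun x => f x / (x - w) ^+ 2)
    (fun x => f x / (x - z) ^+ 1) (-1) (- (z - w)) (16 * M / s ^+ 3 * N (z - w) ^+ 2).
  have -> : sq_int (fun x => f x / (x - z) ^+ 1) o s / twopii R -
      sq_int (fun x => f x / (x - w) ^+ 1) o s / twopii R - G w * (z - w) =
     -1 * (sq_int (fun x => f x / (x - w) ^+ 1) o s / twopii R) +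
     (- (z - w) * G w + sq_int (fun x => f x / (x - z) ^+ 1) o s / twopii R) by ring.
  have -> : K * N (z - w) ^+ 2 = 16 * M / s ^+ 3 * N (z - w) ^+ 2 * (2 * s).
    by rewrite /K; ring.
  apply; [by apply: cpole'; lra|by apply: cpole'; lra|by apply: cpole'; lra|].
  move=> x Hx.
  have xw : s / 2 <= N (x - w) by have := normc_split w x o; case/andP: Hx; lra.
  have xz : s / 4 <= N (x - z) by have := normc_split z x o; case/andP: Hx; lra.
  have xw0 : x - w != 0 by rewrite -normc_gt0; lra.
  have xz0 : x - z != 0 by rewrite -normc_gt0; lra.
  have -> : -1 * (f x / (x - w) ^+ 1) + (- (z - w) * (f x / (x - w) ^+ 2) + f x / (x - z) ^+ 1)
     = f x * (z - w) ^+ 2 / ((x - w) ^+ 2 * (x - z)).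
    by field; rewrite xw0 xz0.
  rewrite normc_div (Normc.normcM (f x)) (Normc.normcM ((x - w) ^+ 2)).
  rewrite !normcX ler_pdivrMr; last first.
    by rewrite mulr_gt0 ?exprn_gt0//; lra.
  have b1 : s ^+ 3 / 16 <= N (x - w) ^+ 2 * N (x - z).
    have -> : s ^+ 3 / 16 = (s / 2) ^+ 2 * (s / 4) by field.
    have p2 : (s / 2) ^+ 2 <= N (x - w) ^+ 2.
      by apply: lerXn2r => //; rewrite nnegrE ?normc_ge0 ?divr_ge0 ?(ltW s0).
    have p4 : 0 <= s / 4 by rewrite divr_ge0 ?(ltW s0).
    exact: (ler_pM (sqr_ge0 _) p4 p2 xz).
  have -> : 16 * M / s ^+ 3 * N (z - w) ^+ 2 * (N (x - w) ^+ 2 * N (x - z)) =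
    M * N (z - w) ^+ 2 * (N (x - w) ^+ 2 * N (x - z) / (s ^+ 3 / 16)).
    by field; rewrite gt_eqF.
  have q1 : 1 <= N (x - w) ^+ 2 * N (x - z) / (s ^+ 3 / 16).
    by rewrite ler_pdivlMr ?mul1r// divr_gt0 ?exprn_gt0.
  apply: le_trans (_ : M * N (z - w) ^+ 2 <= _).
    by rewrite ler_wpM2r ?exprn_ge0 ?normc_ge0//; exact: fM.
  by rewrite ler_peMr// mulr_ge0 ?exprn_ge0 ?normc_ge0// ltW.
have s2 : 0 < s / 2 by lra.
pose G2 := 2 * (sq_int (fun x => f x / (x - o) ^+ 3) o s / twopii R).
suff dG2 : is_derive o 1 G G2.
  have : is_derive o 1 ('D_1 f) G2.
    apply: (is_derive_near s2 _ dG2) => w /dG H; exact/esym/derive_val.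
  by case.
(* 28 is 7 times 4: the numerator factor is at most [3 * (2 * s) + 2 * (s / 2)], the denominator at
   least [s ^+ 3 * (s / 2) ^+ 2]. *)
pose K := 28 * M / s ^+ 4 * (2 * s).
apply: (@is_derive_quadratic _ _ _ (s / 2) K) => //.
  by rewrite !mulr_ge0 ?invr_ge0 ?exprn_ge0 ?(ltW M0) ?(ltW s0).
move=> z zo.
have := quot3 (fun x => f x / (x - o) ^+ 2) (fun x => f x / (x - o) ^+ 3)
    (fun x => f x / (x - z) ^+ 2) (-1) (- (2 * (z - o))) (28 * M / s ^+ 4 * N (z - o) ^+ 2).
have -> : G z - G o - G2 * (z - o) = -1 * G o + (- (2 * (z - o)) *
   (sq_int (fun x => f x / (x - o) ^+ 3) o s / twopii R) + G z) by rewrite /G2; ring.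
have -> : K * N (z - o) ^+ 2 = 28 * M / s ^+ 4 * N (z - o) ^+ 2 * (2 * s).
  by rewrite /K; ring.
apply; [by apply: cpole'; lra|by apply: cpole'; lra|by apply: cpole'; lra|].
move=> x Hx; have [xo xo2] := andP Hx.
have xz : s / 2 <= N (x - z) by have := normc_split z x o; lra.
have xo0 : x - o != 0 by rewrite -normc_gt0; lra.
have xz0 : x - z != 0 by rewrite -normc_gt0; lra.
have -> : -1 * (f x / (x - o) ^+ 2) + (- (2 * (z - o)) * (f x / (x - o) ^+ 3) + f x / (x - z) ^+ 2)
   = f x * (z - o) ^+ 2 * (3 * (x - o) - 2 * (z - o)) / ((x - o) ^+ 3 * (x - z) ^+ 2).
  by field; rewrite xo0 xz0.
rewrite normc_div (Normc.normcM (f x * _)) (Normc.normcM (f x)) (Normc.normcM ((x - o) ^+ 3)).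
rewrite !normcX ler_pdivrMr; last first.
  by rewrite mulr_gt0 ?exprn_gt0//; lra.
have b0 : N (3 * (x - o) - 2 * (z - o)) <= 7 * s.
  apply: le_trans (normcB _ _) _; rewrite !Normc.normcM !normc_nat; lra.
have b1 : s ^+ 5 / 4 <= N (x - o) ^+ 3 * N (x - z) ^+ 2.
  have -> : s ^+ 5 / 4 = s ^+ 3 * (s / 2) ^+ 2 by field.
  have p2 : (s / 2) ^+ 2 <= N (x - z) ^+ 2.
    by apply: lerXn2r => //; rewrite nnegrE ?normc_ge0 ?(ltW s2).
  have p3 : s ^+ 3 <= N (x - o) ^+ 3.
    by apply: lerXn2r => //; rewrite nnegrE ?normc_ge0 ?(ltW s0).
  exact: (ler_pM (exprn_ge0 3 (ltW s0)) (exprn_ge0 2 (ltW s2)) p3 p2).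
have s5 : 0 < s ^+ 5 / 4 by rewrite divr_gt0 ?exprn_gt0.
have -> : 28 * M / s ^+ 4 * N (z - o) ^+ 2 * (N (x - o) ^+ 3 * N (x - z) ^+ 2) =
  M * N (z - o) ^+ 2 * (7 * s) * (N (x - o) ^+ 3 * N (x - z) ^+ 2 / (s ^+ 5 / 4)).
  by field; rewrite gt_eqF.
have q1 : 1 <= N (x - o) ^+ 3 * N (x - z) ^+ 2 / (s ^+ 5 / 4).
  by rewrite ler_pdivlMr ?mul1r.
have n0 := normc_ge0 (z - o).
apply: le_trans (_ : M * N (z - o) ^+ 2 * (7 * s) <= _).
  apply: ler_pM; rewrite ?mulr_ge0 ?exprn_ge0 ?normc_ge0//.
  by rewrite ler_wpM2r ?exprn_ge0//; exact: fM.
by rewrite ler_peMr// !mulr_ge0 ?exprn_ge0 ?(ltW M0)// ltW.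
Qed.

End Consequences.

(** * Logarithms and the identity theorem *)

Section Log.
Variable R : realType.
Local Notation C := R[i].
Local Notation N := (@Normc.normc R).
Local Notation Re := complex.Re.
Implicit Types (x y z w o p h : C) (r s t d : R) (f g k : C -> C) (m n : nat).

(** By Cauchy's theorem for the triangle [p], [z], [w], the increment is the integral from [z] to
    [w], where [f] is close to [f z]. *)
Lemma primitive f p r z : (forall x, N (x - p) <= r -> derivable f x 1) ->
  N (z - p) < r -> is_derive z 1 (fun w => seg_int f p w) (f z).
Proof.
move=> df zr; apply/is_deriveCP => e e0.
have r0 : 0 <= r by have := normc_ge0 (z - p); lra.
have [d d0 Hd] := (continuous_normcP f z).1 (derivable_cont (df z (ltW zr))) e e0.
exists (Num.min d (r - N (z - p))); first by rewrite lt_min d0 subr_gt0.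
move=> w; rewrite lt_min => /andP[wd wr].
(* For [v = 0] the half-plane condition is void and [region] is a closed disc. *)
pose P := region p r 0 0 0.
have PE x : N (x - p) <= r -> P x by move=> xr; split => //; rewrite mul0r.
have dP x : P x -> derivable f x 1 by move=> [xr _]; exact: df.
have wp : N (w - p) <= r by have := normc_split z w p; lra.
have Pp : P p by apply: PE; rewrite subrr Normc.normc0.
have Pz : P z by apply: PE; exact: ltW.
have Pw : P w by exact: PE.
have cs a b : P a -> P b -> cont_on (seg a b) f.
  by move=> Pa Pb x /(region_convex Pa Pb) /dP; exact: derivable_cont.
have := cauchy_triangle (@region_convex R p r 0 0 0) (@region_closed R p r 0 0 0) dP Pp Pz Pw.
rewrite /tri_int (seg_intN (cs _ _ Pp Pw)) => /eqP; rewrite subr_eq0 => /eqP <-.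
have -> : seg_int f p z + seg_int f z w - seg_int f p z - f z * (w - z) =
   seg_int f z w - (f z * (w - z) + 0 * (w ^+ 2 - z ^+ 2) / 2) by ring.
apply: seg_int_affine_le; first exact: cs.
move=> x /seg_dist xz; rewrite mul0r addr0; apply: Hd; exact: le_lt_trans wd.
Qed.

(** The hypothesis makes the derivative vanish on [[0, 1]], so the mean value theorem applies. The
    increment form matches the complex estimates it is fed with along a segment. *)
Lemma eq_of_small_increments (phi : R -> R) :
  (forall t, 0 <= t <= 1 -> forall e, 0 < e -> exists2 d, 0 < d &
    forall s, `|s - t| < d -> `|phi s - phi t| <= e * `|s - t|) -> phi 1 = phi 0.
Proof.
move=> H.
have D t : 0 <= t <= 1 -> is_derive t 1 phi 0.
  move=> t01.
  have c : h^-1 *: ((phi \o shift t) (h *: 1) - phi t) @[h --> 0^'] --> (0 : R).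
    apply/cvgr0Pnorm_le => e e0; rewrite near_withinE.
    have [d d0 Hd] := H t t01 e e0.
    near=> h => h0 /=; rewrite /GRing.scale /= mulr1 normrM normfV.
    rewrite ler_pdivrMl ?normr_gt0// [leRHS]mulrC.
    have := Hd (h + t); rewrite addrK; apply.
    by near: h; apply: (@nbhs0_lt R R).
  by split; [apply/cvg_ex; exists 0|exact: cvg_lim c].
have [||c _ E] := @MVT R phi (fun=> 0) 0 1 ltr01.
- by move=> x; rewrite in_itv/= => /andP[a b]; apply: D; rewrite !ltW.
- by apply: derivable_within_continuous => x; rewrite in_itv/= => /D[].
by move: E; rewrite mul0r => /eqP; rewrite subr_eq0 => /eqP.
Unshelve. all: end_near. Qed.

(** * The logarithm of the modulus of a holomorphic function *)

Lemma normc1D_sqr u : N (1 + u) ^+ 2 = 1 + (2 * Re u + N u ^+ 2).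
Proof.
case: u => a b; rewrite /Normc.normc /= add0r !sqr_sqrtr ?addr_ge0 ?sqr_ge0//; ring.
Qed.

(** With [v = 2 * Re u + N u ^+ 2], twice the logarithm is [ln (1 + v)], which lies between
    [v / (1 + v)] and [v]. Here [1 + v] is at least 1/4 and [v] at most [5 / 2 * N u] in modulus, so
    12 would already do for 13. *)
Lemma ln_normc1D u : N u <= 1 / 2 -> `|ln (N (1 + u)) - Re u| <= 13 * N u ^+ 2.
Proof.
move=> u2; have := normc_Re u; rewrite ler_norml => /andP[u3 u4].
have u0 := normc_ge0 u.
have n1 : 1 / 2 <= N (1 + u).
  by have := normcBr 1 (- u); rewrite opprK normc_opp Normc.normc1; lra.
set a := N u in u0 u2 u3 u4 *; set b := Re u in u3 u4 *.
set v := 2 * b + a ^+ 2.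
have E : N (1 + u) ^+ 2 = 1 + v by exact: normc1D_sqr.
have v1 : 1 / 4 <= 1 + v by rewrite -E; nra.
have lnE : ln (1 + v) = 2 * ln (N (1 + u)).
  by rewrite -E lnXn; [rewrite mulr_natl|lra].
have up : ln (1 + v) <= v by apply: le_ln1Dx; lra.
have lo : v / (1 + v) <= ln (1 + v).
  have v0 : 1 + v \in Num.pos by rewrite posrE; lra.
  have := @le_ln1Dx R (- (v / (1 + v))).
  have -> : 1 - v / (1 + v) = (1 + v)^-1 by field; rewrite gt_eqF//; lra.
  rewrite lnV// lerN2; apply.
  rewrite ltrN2 ltr_pdivrMr; lra.
have lo' : v - 4 * v ^+ 2 <= v / (1 + v).
  rewrite ler_pdivlMr; last by lra.
  have := sqr_ge0 v; nra.
have va : v ^+ 2 <= 25 / 4 * a ^+ 2.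
  have h1 : v <= 5 / 2 * a by rewrite /v; nra.
  have h2 : - (5 / 2 * a) <= v by rewrite /v; nra.
  by nra.
have vE : v = 2 * b + a ^+ 2 by [].
by rewrite ler_norml; apply/andP; split; lra.
Qed.

Lemma ln_normc_derive f x l : f x != 0 -> is_derive x 1 f l ->
  forall e, 0 < e -> exists2 d, 0 < d & forall w, N (w - x) < d ->
    `|ln (N (f w)) - ln (N (f x)) - Re (l / f x * (w - x))| <= e * N (w - x).
Proof.
move=> fx0 /is_deriveCP H e e0.
have nf : 0 < N (f x) by rewrite normc_gt0.
have [d d0 Hd] := H (N (f x) * (e / 2)) ltac:(by rewrite mulr_gt0//; lra).
pose K := N (l / f x) + e / 2.
have K0 : 0 < K by have := normc_ge0 (l / f x); rewrite /K; lra.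
(* The three bounds serve, in order, the linearisation of [f], the condition [N u <= 1 / 2], and
   [13 * N u ^+ 2 <= e / 2 * N (w - x)]. *)
exists (Num.min d (Num.min (1 / (2 * K)) (e / (26 * K ^+ 2)))).
  by rewrite !lt_min d0 /= !divr_gt0// ?mulr_gt0 ?exprn_gt0.
move=> w; rewrite !lt_min => /and3P[wd].
rewrite !ltr_pdivlMr ?mulr_gt0 ?exprn_gt0// => w1 w2.
have n0 := normc_ge0 (w - x).
pose u := (f w - f x) / f x.
have fw : f w = f x * (1 + u) by rewrite /u; field.
have uq : N (u - l / f x * (w - x)) <= e / 2 * N (w - x).
  have -> : u - l / f x * (w - x) = (f w - f x - l * (w - x)) / f x by rewrite /u; field.
  rewrite normc_div ler_pdivrMr//.
  have -> : e / 2 * N (w - x) * N (f x) = N (f x) * (e / 2) * N (w - x) by ring.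
  exact: Hd.
have uK : N u <= K * N (w - x).
  have := normcD (u - l / f x * (w - x)) (l / f x * (w - x)).
  rewrite subrK (Normc.normcM (l / f x)) /K; lra.
have u2 : N u <= 1 / 2 by lra.
have n1 : 0 < N (1 + u).
  by have := normcBr 1 (- u); rewrite opprK normc_opp Normc.normc1; lra.
have -> : ln (N (f w)) = ln (N (f x)) + ln (N (1 + u)).
  by rewrite fw Normc.normcM lnM ?posrE.
have -> : ln (N (f x)) + ln (N (1 + u)) - ln (N (f x)) - Re (l / f x * (w - x)) =
  (ln (N (1 + u)) - Re u) + Re (u - l / f x * (w - x)) by rewrite ReB; ring.
apply: le_trans (ler_normD _ _) _.
have := ln_normc1D u2; have := normc_Re (u - l / f x * (w - x)).
have : 13 * N u ^+ 2 <= e / 2 * N (w - x).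
  apply: le_trans (_ : 13 * (K * N (w - x)) ^+ 2 <= _).
    by rewrite ler_wpM2l//; apply: lerXn2r => //; rewrite nnegrE ?normc_ge0// mulr_ge0// ltW.
  have -> : 13 * (K * N (w - x)) ^+ 2 = (N (w - x) * (26 * K ^+ 2)) / 2 * N (w - x) by field.
  by rewrite ler_wpM2r//; lra.
lra.
Qed.

(** [L] is the primitive of ['D_1 f / f] from [p]. Along the segment from [p] to [z],
    [ln (N f) - Re L] has derivative zero; neither the exponential nor a branch of the logarithm is
    involved. *)
Lemma log_modulus f p r : (forall x, derivable f x 1) ->
  (forall x, N (x - p) <= r -> f x != 0) ->
  exists L : C -> C, [/\ L p = 0, forall z, N (z - p) < r -> derivable L z 1 &
    forall z, N (z - p) < r -> ln (N (f z)) = ln (N (f p)) + Re (L z)].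
Proof.
move=> df f0; pose q x := 'D_1 f x / f x.
have dq x : N (x - p) <= r -> derivable q x 1.
  move=> /f0 fx; have dd : derivable ('D_1 f) x 1.
    by apply: (@derivable_derive R f x 1) => // y _; exact: df.
  exact: (@derivable_div R ('D_1 f) f x dd (df x) fx).
have dL z : N (z - p) < r -> is_derive z 1 (fun w => seg_int q p w) (q z).
  exact: primitive.
have ipp : seg_int q p p = 0.
  (* For [r < 0] nothing is known of [q] at [p], but every midpoint sum over the degenerate segment
     is zero. *)
  have [r0|r0] := ltP r 0.
    rewrite /seg_int (_ : (fun _ => _) = fun=> 0); first exact: lim_cst.
    apply/funext => k; elim: k => [|k IH] /=; first by rewrite subrr mul0r.
    by rewrite (_ : (p + p) / 2 = p) ?IH ?addr0//; field.
  have cpp : cont_on (seg p p) q.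
    move=> x [t _ ->]; rewrite subrr mulr0 addr0; apply: derivable_cont.
    by apply: dq; rewrite subrr Normc.normc0.
  have := seg_intN cpp => /eqP; rewrite -addr_eq0 -mulr2n mulrn_eq0 /=.
  by move/eqP.
exists (fun w => seg_int q p w); split => //.
  by move=> z /dL [].
move=> z zr.
pose ga t := p + t%:C%C * (z - p).
have gar t : 0 <= t <= 1 -> N (ga t - p) < r.
  move=> t01; apply: le_lt_trans zr; apply: seg_dist.
  by exists t.
have gaB s t : ga s - ga t = (s - t)%:C%C * (z - p).
  by rewrite /ga rmorphB; ring.
pose phi t := ln (N (f (ga t))) - Re (seg_int q p (ga t)).
suff : phi 1 = phi 0.
  rewrite /phi /ga mul1r mul0r addr0 (addrC p) subrK ipp /=; lra.
apply: eq_of_small_increments => t t01 e e0.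
(* Two linearisation errors share [e], hence the 2; the 1 keeps the divisor positive when
   [z = p]. *)
have D0 : 0 < 2 * N (z - p) + 1 by have := normc_ge0 (z - p); lra.
have e1 : 0 < e / (2 * N (z - p) + 1) by rewrite divr_gt0.
have tr := gar t t01.
have [d1 d10 H1] := ln_normc_derive (f0 _ (ltW tr)) (derivableP (df (ga t))) e1.
have [d2 d20 H2] := (is_deriveCP _ _ _).1 (dL _ tr) _ e1.
exists (Num.min d1 d2 / (2 * N (z - p) + 1)).
  by rewrite divr_gt0// lt_min d10.
move=> s; rewrite ltr_pdivlMr// => sd.
have gd : N (ga s - ga t) = `|s - t| * N (z - p) by rewrite gaB Normc.normcM normc_real.
have : N (ga s - ga t) < Num.min d1 d2.
  apply: le_lt_trans sd; rewrite gd ler_wpM2l//; have := normc_ge0 (z - p); lra.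
rewrite lt_min => /andP[/H1 {}H1 /H2 {}H2].
have -> : phi s - phi t =
   (ln (N (f (ga s))) - ln (N (f (ga t))) - Re (q (ga t) * (ga s - ga t)))
   - Re (seg_int q p (ga s) - seg_int q p (ga t) - q (ga t) * (ga s - ga t)).
  by rewrite /phi !ReB; ring.
apply: le_trans (ler_normB _ _) _; apply: le_trans (lerD H1 (le_trans (normc_Re _) H2)) _.
rewrite gd.
have -> : e / (2 * N (z - p) + 1) * (`|s - t| * N (z - p)) +
  e / (2 * N (z - p) + 1) * (`|s - t| * N (z - p)) =
  e * `|s - t| * (2 * N (z - p) / (2 * N (z - p) + 1)) by field; rewrite gt_eqF.
apply: ler_piMr; first by rewrite mulr_ge0// ltW.
by rewrite ler_pdivrMr// mul1r lerDl.
Qed.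

Lemma borel_caratheodory k p r (M : R) : 0 < r -> 0 < M ->
  (forall x, N (x - p) <= r -> derivable k x 1) -> k p = 0 ->
  (forall x, N (x - p) <= r -> Re (k x) <= M) ->
  forall w, N (w - p) <= r / 16 -> N (k w) <= 2 * M.
Proof.
move=> r0 M0 dk kp kM w wr.
(* Schwarz's lemma applies to [k / (2 M - k)], of modulus at most 1. *)
pose m : C := (2 * M)%:C%C.
have Nm : N m = 2 * M by rewrite normc_real ger0_norm//; lra.
have le x : N (x - p) <= r -> N (k x) <= N (m - k x) /\ m - k x != 0.
  move=> /kM; case: (k x) => a b /= aM; split.
    rewrite ler_sqrt ?addr_ge0 ?sqr_ge0// sub0r sqrrN lerD2r; nra.
  by apply/eqP => /(congr1 (@complex.Re R)) /=; lra.
have dh x : N (x - p) <= r -> derivable (fun x => k x / (m - k x)) x 1.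
  move=> xr; have [_ x0] := le x xr.
  have dm : derivable (fun x => m - k x) x 1.
    exact: (@derivableB _ _ _ (fun=> m) k x 1 (@derivable_cst _ _ _ m x 1) (dk x xr)).
  exact: (@derivable_div R k (fun x => m - k x) x (dk x xr) dm x0).
have h1 x : N (x - p) <= r -> N (k x / (m - k x)) <= 1.
  move=> /le[h x0]; rewrite normc_div ler_pdivrMr ?mul1r//.
  by rewrite normc_gt0.
have h0 : k p / (m - k p) = 0 by rewrite kp mul0r.
have wr' : N (w - p) <= r / 4 by lra.
have := schwarz dh r0 h0 h1 wr'.
have [_ w0] := le w ltac:(lra).
have w00 : 0 < N (m - k w) by rewrite normc_gt0.
rewrite normc_div ler_pdivrMr// mulr1.
have := normcB m (k w); rewrite Nm.
(* With factor 1/2, [N (k w)] is at most half of [2 * M + N (k w)], which gives [2 * M]. *)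
have : 8 * N (w - p) / r <= 1 / 2 by rewrite ler_pdivrMr//; lra.
nra.
Qed.

(** [propagation] with [t = 0] and [n] arbitrarily large; the resulting radius does not depend on
    [r']. *)
Lemma vanishing_disc f o r r' (M : R) :
  (forall x, N (x - o) <= r -> derivable f x 1) -> 0 < r' -> r' <= r ->
  (forall x, N (x - o) <= r -> N (f x) <= M) ->
  (forall x, N (x - o) <= r' -> f x = 0) ->
  forall w, N (w - o) <= r / 4 -> f w = 0.
Proof.
move=> df r0' rr' fM f0 w wr; apply/eqP; rewrite -normc_eq0 eq_le normc_ge0 andbT.
apply/ler_addgt0Pr => e e0; rewrite add0r.
have [n Hn] := half_cvg0 (4 * M) e0; apply: le_trans (Hn n (leqnn n)).
have := @propagation R f o r r' M 0 n w df r0' rr' fM; rewrite mul0r add0r; apply => //.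
by move=> x /f0 ->; rewrite Normc.normc0.
Qed.

(** * The identity theorem *)

Lemma open_normcP (D : set C) z : open D -> D z ->
  exists2 d, 0 < d & forall w, N (w - z) < d -> D w.
Proof. by move=> Do Dz; apply/nbhs_normcP; exact: open_nbhs_nbhs. Qed.

(** The set of points near which [g] vanishes is open, and relatively closed in the connected set
    [B]; for closedness it is essential that [vanishing_disc] has a radius independent of the
    initial disc. *)
Lemma identity_theorem (D : set C) g q : open D -> holomorphic D g ->
  (\forall x \near q, g x = 0) -> forall w, connected_component D q w -> g w = 0.
Proof.
move=> Do hg g0 w [B [Bq BD Bc] Bw].
pose O := [set z : C | \forall x \near z, g x = 0].
have Oo : open O.
  by rewrite openE => z; rewrite /O /interior /= => /nbhs_interior.
have E : B `&` O = B.
  apply: Bc.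
  - by exists q.
  - by exists O.
  exists (closure O); first exact: closed_closure.
  apply/seteqP; split => z [Bz Oz].
    by split; [exact: Bz|exact: subset_closure].
  split; first exact: Bz.
  have Dz := BD _ Bz.
  have [d1 d10 H1] := open_normcP Do Dz.
  have [d2 d20 H2] := continuous_bounded (derivable_cont (hg z Dz)).
  pose d := Num.min d1 d2.
  have [dd1 dd2] : d <= d1 /\ d <= d2 by split; rewrite ge_min lexx ?orbT.
  have d0 : 0 < d by rewrite lt_min d10.
  (* With [p] within [d / 16] of [z], the disc of radius [d / 16] around [z] lies within [d / 8] of
     [p], a quarter of the radius [d / 2]. *)
  have [|p [Op pz]] := Oz [set y | N (y - z) < d / 16].
    by apply/nbhs_normcP; exists (d / 16) => //; lra.
  rewrite /= in pz.
  have inr x : N (x - p) <= d / 2 -> N (x - z) < d.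
    by move=> h; have := normc_split p x z; lra.
  have [r0 r00 Hr] := (nbhs_normcP _ _).1 Op.
  have m0 : Num.min (r0 / 2) (d / 2) <= r0 / 2 /\ Num.min (r0 / 2) (d / 2) <= d / 2.
    by split; rewrite ge_min lexx ?orbT.
  have [m1 m2] := m0.
  apply/nbhs_normcP; exists (d / 16); first lra.
  have v1 x : N (x - p) <= d / 2 -> derivable g x 1.
    by move=> /inr xd; apply: hg; apply: H1; exact: lt_le_trans dd1.
  have v2 : 0 < Num.min (r0 / 2) (d / 2) by rewrite lt_min; apply/andP; split; lra.
  have v3 x : N (x - p) <= d / 2 -> N (g x) <= N (g z) + 1.
    by move=> /inr xd; apply: H2; exact: lt_le_trans dd2.
  have v4 x : N (x - p) <= Num.min (r0 / 2) (d / 2) -> g x = 0.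
    by move=> h; apply: Hr; lra.
  move=> x xz; have xp : N (x - p) <= d / 2 / 4.
    by have := normc_split z x p; rewrite (normc_distC z); lra.
  exact: (vanishing_disc v1 v2 m2 v3 v4 xp).
have : (B `&` O) w by rewrite E.
by move=> [_ /nbhs_singleton].
Qed.

End Log.

(** * Growth exponents *)

Section Main.
Variable R : realType.
Local Notation C := R[i].
Local Notation N := (@Normc.normc R).
Local Notation Re := complex.Re.
Implicit Types (x y z w o p h : C) (r s t d : R) (g k : C -> C) (m n : nat).

Lemma limn_esup_lt (u : nat -> \bar R) (a : \bar R) : (limn_esup u < a)%E ->
  exists n0, forall n, (n0 <= n)%N -> (u n <= a)%E.
Proof.
move=> /ereal_inf_lt[_ [V [n0 _ Hn] <-] Va]; exists n0 => n nn.
apply: le_trans (ltW Va); apply: ereal_sup_ubound; exists n => //; exact: Hn.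
Qed.

Lemma limn_esup_le (u : nat -> \bar R) (a : \bar R) n0 :
  (forall n, (n0 <= n)%N -> (u n <= a)%E) -> (limn_esup u <= a)%E.
Proof.
move=> H; apply: (@le_trans _ _ (ereal_sup (u @` [set n | (n0 <= n)%N]))).
  by apply: ereal_inf_lbound; exists [set n | (n0 <= n)%N] => //; exists n0.
by apply: ge_ereal_sup => _ [n nn <-]; exact: H.
Qed.

Lemma disc_compact o r : compact [set x : C | N (x - o) <= r].
Proof.
pose sqr := (fun q : R * R => o + (q.1 +i* q.2)%C) @` (`[- r, r] `*` `[- r, r]).
apply: (@subclosed_compact _ _ sqr).
- move=> x clx /=; apply/ler_addgt0Pl => e e0.
  have [|y [/= yr yx]] := clx [set y | N (y - x) < e].
    by apply/nbhs_normcP; exists e.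
  by have := normc_split y x o; rewrite (normc_distC x y); lra.
- apply: continuous_compact; last by apply: compact_setX; exact: segment_compact.
  apply: continuous_subspaceT => q; apply/cvg_normcP => e e0.
  have e2 : 0 < e / 2 by lra.
  near=> q'.
  have -> : o + (q'.1 +i* q'.2)%C - (o + (q.1 +i* q.2)%C) = ((q'.1 - q.1) +i* (q'.2 - q.2))%C.
    by rewrite opprD addrACA subrr add0r.
  apply: le_trans (normc_ReIm _) _ => /=; rewrite (splitr e); apply: lerD.
    rewrite distrC; near: q'.
    by apply: (@cvgr_dist_le _ _ _ _ _ (fst : R * R -> R) q.1) => //; exact: cvg_fst.
  rewrite distrC; near: q'.
  by apply: (@cvgr_dist_le _ _ _ _ _ (snd : R * R -> R) q.2) => //; exact: cvg_snd.
- move=> x /= xr; exists (Re (x - o), complex.Im (x - o)); last first.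
    by case: (x - o) (subrK o x) => a b /= <-; rewrite addrC.
  have := normc_Re (x - o); have := normc_Im (x - o).
  rewrite !ler_norml => /andP[a b] /andP[c d].
  by split => /=; rewrite in_itv/=; apply/andP; split; lra.
Unshelve. all: end_near. Qed.

Lemma uniform_limit (f : nat -> C -> C) g (K : set C) :
  {uniform K, f @ \oo --> g} ->
  forall e : R, 0 < e -> exists n0, forall n, (n0 <= n)%N ->
    forall z, K z -> N (f n z - g z) < e.
Proof.
move=> H e e0.
have e0' : 0 < e%:C%C :> C by rewrite ltcR.
have : nbhs (g : {uniform` K -> C})
    [set h : {uniform` K -> C} | forall y, K y -> ball (g y) (e%:C%C) (h y)].
  apply/uniform_nbhs; exists [set xy | ball xy.1 (e%:C%C) xy.2]; split => //.
  exact: (entourage_ball C (PosNum e0')).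
move=> /H[n0 _ Hn]; exists n0 => n /Hn /= hn z /hn.
by rewrite -ball_normE /= norm_normc ltcR normc_distC.
Qed.

(* The normalised logarithms [ln |f n| / lambda n] are real parts of holomorphic
   functions that are uniformly bounded on the large disc and tend to [0] on the
   small one, hence tend to [0] on a disc of radius comparable to the large one. *)
Lemma log_growth_le (f : nat -> C -> C) (lambda : nat -> R) p r r' (M Q : R) n0 :
  (forall n, entire (f n)) -> lambda n @[n --> \oo] --> +oo%R ->
  0 < r' -> r' <= r -> 0 < M -> 0 <= Q ->
  (forall n x, (n0 <= n)%N -> N (x - p) <= r ->
     f n x != 0 /\ ln (N (f n x)) <= M * lambda n) ->
  (forall n x, (n0 <= n)%N -> N (x - p) <= r' -> `|ln (N (f n x))| <= Q) ->
  forall w, N (w - p) <= r / 128 -> forall e, 0 < e ->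
  exists n1, forall n, (n1 <= n)%N -> ln (N (f n w)) <= e * lambda n.
Proof.
move=> fe lam r0' rr' M0 Q0 fM fQ w wr e e0.
have r0 : 0 < r by lra.
have lamge A : exists n1, forall n, (n1 <= n)%N -> A <= lambda n.
  by have /cvgryPge/(_ A)[n1 _ Hn] := lam; exists n1.
(* The number of Taylor terms is fixed before [n]: it brings the remainder below [e / 4]. *)
have [m Hm] := half_cvg0 (4 * (2 * (M + 1))) (divr_gt0 e0 (ltr0Sn R 3)).
have {}Hm := Hm m (leqnn m).
pose S := 2 * \sum_(0 <= i < m) (r / 32 / (r' / 32)) ^+ i.
have S0 : 0 <= S.
  rewrite /S mulr_ge0// sumr_ge0// => i _; rewrite exprn_ge0// divr_ge0//; lra.
have [n1 Hn1] := lamge (Q + 1).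
(* The first summand absorbs [ln (N (f n p))], the second brings the coefficient sum below
   [e / 4]. *)
have [n2 Hn2] := lamge (4 * Q / e + 4 * (2 * (2 * Q + 1)) * S / e).
exists (maxn n0 (maxn n1 n2)) => n; rewrite !geq_max => /and3P[nn0 /Hn1 l1 /Hn2 l2].
have l0 : 0 < lambda n by lra.
have fn x : derivable (f n) x 1 by exact: fe.
have fn0 x : N (x - p) <= r -> f n x != 0 by move=> /(fM n x nn0)[].
have pp : N (p - p) = 0 by rewrite subrr Normc.normc0.
have [L [Lp dL lnL]] := log_modulus fn fn0.
pose k x := (lambda n)^-1%:C%C * L x.
have Rek x : Re (k x) = Re (L x) / lambda n by rewrite /k Re_realM mulrC.
have dk x : N (x - p) < r -> derivable k x 1.
  move=> xr; exact: (@derivableM _ _ (fun=> (lambda n)^-1%:C%C) L x 1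
    (@derivable_cst _ _ _ _ x 1) (dL x xr)).
have kp : k p = 0 by rewrite /k Lp mulr0.
have Qp : `|ln (N (f n p))| <= Q by apply: fQ => //; rewrite pp; lra.
move: Qp; rewrite ler_norml => /andP[Qp1 Qp2].
(* Subtracting the value at [p] costs at most [Q <= lambda n], hence [M + 1]. The radius is halved
   because [L] is controlled on the open disc only, then divided by 16. *)
have k1 x : N (x - p) <= r / 32 -> N (k x) <= 2 * (M + 1).
  have h1 : 0 < r / 2 by lra.
  have h2 : 0 < M + 1 by lra.
  have h3 y : N (y - p) <= r / 2 -> derivable k y 1 by move=> yr; apply: dk; lra.
  have h4 y : N (y - p) <= r / 2 -> Re (k y) <= M + 1.
    move=> yr; rewrite Rek ler_pdivrMr//.
    have := lnL y ltac:(lra); have [_] := fM n y nn0 ltac:(lra).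
    have : Q <= lambda n by lra.
    by nra.
  move=> xr; apply: (borel_caratheodory h1 h2 h3 kp h4); lra.
(* The difference of two logarithms is at most [2 * Q]; the extra 1 keeps the bound positive if
   [Q = 0]. *)
have k2 x : N (x - p) <= r' / 32 -> N (k x) <= 2 * ((2 * Q + 1) / lambda n).
  have h1 : 0 < r' / 2 by lra.
  have h2 : 0 < (2 * Q + 1) / lambda n by rewrite divr_gt0//; lra.
  have h3 y : N (y - p) <= r' / 2 -> derivable k y 1 by move=> yr; apply: dk; lra.
  have h4 y : N (y - p) <= r' / 2 -> Re (k y) <= (2 * Q + 1) / lambda n.
    move=> yr; rewrite Rek; apply: ler_wpM2r; first by rewrite invr_ge0 ltW.
    have := lnL y ltac:(lra).
    by have := fQ n y nn0 ltac:(lra); rewrite ler_norml => /andP[_]; lra.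
  move=> xr; apply: (borel_caratheodory h1 h2 h3 kp h4); lra.
have k3 x : N (x - p) <= r / 32 -> derivable k x 1 by move=> xr; apply: dk; lra.
have r32 : 0 < r' / 32 by lra.
have rr32 : r' / 32 <= r / 32 by lra.
have w32 : N (w - p) <= r / 32 / 4 by lra.
have wk := propagation m k3 r32 rr32 k1 k2 w32.
rewrite -/S in wk.
have {wk} wk : N (k w) <= e / 2.
  apply: le_trans wk _.
  have : 2 * ((2 * Q + 1) / lambda n) * S <= e / 4.
    have -> : 2 * ((2 * Q + 1) / lambda n) * S = 2 * (2 * Q + 1) * S / lambda n.
      by field; rewrite gt_eqF.
    rewrite ler_pdivrMr//.
    have : 4 * (2 * (2 * Q + 1)) * S / e <= lambda n.
      apply: le_trans l2; rewrite lerDr; apply: divr_ge0; lra.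
    rewrite ler_pdivrMr//; lra.
  by lra.
have := lnL w ltac:(lra); have := Re_le (k w); rewrite Rek ler_pdivrMr//.
have : 4 * Q / e <= lambda n.
  by apply: le_trans l2; rewrite lerDl; apply: divr_ge0; [apply: mulr_ge0 => //; lra|lra].
rewrite ler_pdivrMr//; nra.
Qed.

Lemma growth_le1 (f : nat -> C -> C) (lambda : nat -> R) w n0 :
  lambda n @[n --> \oo] --> +oo%R ->
  (forall n, (n0 <= n)%N -> f n w != 0) ->
  (forall e, 0 < e -> exists n1, forall n, (n1 <= n)%N ->
     ln (N (f n w)) <= e * lambda n) ->
  (growth f lambda w <= 1)%E.
Proof.
move=> lam f0 H; apply/lee_addgt0Pr => e e0.
have e1 : 0 < ln (1 + e) by apply: ln_gt0; lra.
have [n1 Hn1] := H _ e1.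
have /cvgryPge/(_ 1)[n2 _ Hn2] := lam.
apply: (@limn_esup_le _ _ (maxn n0 (maxn n1 n2))) => n.
rewrite !geq_max => /and3P[/f0 fn0 /Hn1 l1 /Hn2 /= l2].
rewrite /growth_term -EFinD lee_fin /powR normc_eq0 (negPf fn0).
rewrite -[leRHS]lnK ?posrE; last by lra.
by rewrite ler_expR mulrC ler_pdivrMr//; lra.
Qed.

(** The logarithm of a positive number is below the number, so a bound on the root of index
    [lambda n] is itself a bound on [ln (N (f n x)) / lambda n]. *)
Lemma admissible_bound (f : nat -> C -> C) (lambda : nat -> R) (K : set C) :
  admissible f lambda -> compact K -> exists2 M : R, 0 < M &
  exists n0, forall n x, (n0 <= n)%N -> K x -> f n x != 0 ->
    ln (N (f n x)) <= M * lambda n.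
Proof.
move=> [_ lam H] /H[c cle].
have : (limn_esup (fun n => ereal_sup (growth_term f lambda n @` K)) < (`|c| + 1)%:E)%E.
  by apply: le_lt_trans cle _; rewrite lte_fin; have := ler_norm c; lra.
move=> /limn_esup_lt[n1 Hn1].
have /cvgryPge/(_ 1)[n2 _ Hn2] := lam.
exists (`|c| + 1); first by have := normr_ge0 c; lra.
exists (maxn n1 n2) => n x; rewrite geq_max => /andP[/Hn1 l1 /Hn2 /= l2] Kx fx.
have l0 : 0 < lambda n by lra.
have fx0 : 0 < N (f n x) by rewrite normc_gt0.
have : ((Normc.normc (f n x) `^ (lambda n)^-1)%:E <= (`|c| + 1)%:E)%E.
  by apply: le_trans l1; apply: ereal_sup_ubound; exists x.
rewrite lee_fin => h.
have := @ln_sublinear R _ (powR_gt0 (lambda n)^-1 fx0).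
rewrite ln_powR => h'; rewrite -ler_pdivrMr// mulrC; lra.
Qed.

(** * Choice of the centre [p] and conclusion *)

Lemma ln_sandwich (a t : R) : 0 < a -> a / 4 <= t -> t <= 2 * a ->
  `|ln t| <= `|ln (a / 4)| + `|ln (2 * a)|.
Proof.
move=> a0 h1 h2.
have c1 : ln (a / 4) <= ln t by rewrite ler_ln ?posrE//; lra.
have c2 : ln t <= ln (2 * a) by rewrite ler_ln ?posrE//; lra.
have := ler_norm (ln (2 * a)); have := normr_ge0 (ln (2 * a)).
have := normr_ge0 (ln (a / 4)).
have := ler_norm (- ln (a / 4)); rewrite normrN.
by rewrite ler_norml; move: (`|_|) (`|_|) => ? ? *; apply/andP; split; lra.
Qed.

Lemma normc_sandwich x y z : N (x - y) < N z / 4 -> N (y - z) <= N z / 2 ->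
  N z / 4 <= N x /\ N x <= 2 * N z.
Proof.
move=> xy yz; have := normc_split y x z; have := normcBr x z.
by have := normcBr z x; rewrite (normc_distC z x); split; lra.
Qed.

(** Otherwise [g] vanishes near some [q] in [D], hence on the component of [q]. Which component this
    is depends on [r], so non-constancy is used for all of them. *)
Lemma nonvanishing_near (D : set C) g z r : open D -> holomorphic D g ->
  nonconstant D g -> closure D z -> 0 < r ->
  exists p, [/\ D p, N (p - z) < r & g p != 0].
Proof.
move=> Do hg nc clz r0.
have [|q [Dq qz]] := clz [set y | N (y - z) < r].
  by apply/nbhs_normcP; exists r.
apply: contrapT => H; apply: (nc q Dq); exists 0.
apply: identity_theorem => //.
have [d d0 Hd] := open_normcP Do Dq.
apply/nbhs_normcP; exists (Num.min d (r - N (q - z))).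
  by rewrite lt_min d0 subr_gt0.
move=> x; rewrite lt_min => /andP[xd xr]; apply: contrapT => gx; apply: H.
exists x; split; [exact: Hd| |exact/eqP].
by have := normc_split q x z; lra.
Qed.

End Main.

Local Notation N := (@Normc.normc _).

Theorem theorem1 (R : realType) (f : nat -> R[i] -> R[i]) (lambda : nat -> R)
  (g : R[i] -> R[i]) (D : set R[i]) :
  (forall n, entire (f n)) ->
  admissible f lambda ->
  open D ->
  holomorphic D g ->
  nonconstant D g ->
  converges_compactly D f g ->
  forall z0 : R[i],
    (boundary D `&` closure [set z | (1 < growth f lambda z)%E]) z0 ->
    zero_cluster f z0.
Proof.
move=> fe adm Do hg nc fg z0 [[clD _] clmu].
have lam : lambda n @[n --> \oo] --> +oo%R by case: adm.
apply: contrapT => nz.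
have [U [Uo Uz [n0 Un0]]] : exists U : set R[i], [/\ open U, U z0 &
    exists n0, forall n x, (n0 <= n)%N -> U x -> f n x != 0].
  apply: contrapT => H; apply: nz => U Uo Uz n0; apply: contrapT => H'.
  apply: H; exists U; split => //; exists n0 => n x nn Ux; apply/eqP => fx.
  by apply: H'; exists n => //; exists x.
have half_lt (t : R) : 0 < t -> t / 2 < t by move=> ?; lra.
have [rho rho0 Hrho] := open_normcP Uo Uz.
(* The disc of radius [r] around any point within [r / 1024] of [z0] stays within [rho / 2] of [z0],
   where the admissibility bound is taken. *)
pose r := rho / 4.
have r0 : 0 < r by rewrite /r; lra.
have [p [Dp pz gp]] := nonvanishing_near Do hg nc clD (divr_gt0 r0 (ltr0Sn R 1023)).
have gp0 : 0 < N (g p) by rewrite normc_gt0.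
have [M M0 [n1 HM]] := admissible_bound adm (@disc_compact R z0 (rho / 2)).
have [d1 d10 H1] := open_normcP Do Dp.
have [d2 d20 H2] :=
  (continuous_normcP g p).1 (derivable_cont (hg p Dp)) _ (divr_gt0 gp0 (ltr0Sn R 1)).
(* On this disc [g] stays within half of [N (g p)] of [g p]; with [f n] within a quarter of [g], its
   modulus lies between [N (g p) / 4] and [2 * N (g p)]. *)
pose r' := Num.min r (Num.min (d1 / 2) (d2 / 2)).
have r'0 : 0 < r' by rewrite !lt_min r0 !divr_gt0.
have [r'r r'd1 r'd2] : [/\ r' <= r, r' <= d1 / 2 & r' <= d2 / 2].
  by split; rewrite !ge_min lexx ?orbT.
have KD : [set x | N (x - p) <= r'] `<=` D.
  by move=> x /= xr; apply: H1; apply: le_lt_trans (le_trans xr r'd1) _; exact: half_lt.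
have [n2 Hn2] := uniform_limit (fg _ (@disc_compact R p r') KD) (divr_gt0 gp0 (ltr0Sn R 3)).
pose Q := `|ln (N (g p) / 4)| + `|ln (2 * N (g p))|.
have [|w [/= muw wz]] := clmu [set y | N (y - z0) < r / 1024].
  by apply/nbhs_normcP; exists (r / 1024); [exact: (divr_gt0 r0 (ltr0Sn R 1023))|move=> y; exact].
move: muw; apply/negP; rewrite -leNgt.
have inU x : N (x - p) <= r -> U x /\ N (x - z0) <= rho / 2.
  move=> xp; have xz : N (x - z0) <= rho / 2.
    by have := normc_split p x z0; rewrite /r in r0 xp pz; lra.
  by split => //; apply: Hrho; apply: le_lt_trans xz (half_lt _ rho0).
have r128 : r / 128 < r by clear -r0; lra.
(* Both points are within [r / 1024] of [z0]. *)
have wp : N (w - p) <= r / 128.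
  by have := normc_split z0 w p; rewrite (normc_distC z0 p); lra.
apply: (@growth_le1 R f lambda w n0 lam).
  have [Uw _] := inU w (le_trans wp (ltW r128)).
  by move=> n nn; exact: Un0.
have Q0 : 0 <= Q by rewrite addr_ge0.
have q1 n x : (maxn n0 (maxn n1 n2) <= n)%N -> N (x - p) <= r ->
    f n x != 0 /\ ln (N (f n x)) <= M * lambda n.
  rewrite !geq_max => /and3P[nn0 nn1 nn2] /inU[Ux xz].
  by have fx := Un0 n x nn0 Ux; split; [exact: fx|exact: (HM n x nn1 xz fx)].
have q2 n x : (maxn n0 (maxn n1 n2) <= n)%N -> N (x - p) <= r' ->
    `|ln (N (f n x))| <= Q.
  rewrite !geq_max => /and3P[nn0 nn1 nn2] xr.
  have xd2 : N (x - p) < d2 by apply: le_lt_trans (le_trans xr r'd2) _; exact: half_lt.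
  have [b1 b2] := normc_sandwich (Hn2 n nn2 x xr) (H2 x xd2).
  exact: ln_sandwich.
exact: (log_growth_le fe lam r'0 r'r M0 Q0 q1 q2 wp).
Qed.
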